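(* Let $\mathcal N=\{N_i\}_{i\in\mathcal V}$ be an ng-neighborhood for the EVRPTWNL. Call a (partial) subpath or (partial) path *admissible* if it is feasible and ng-feasible with respect to $\mathcal N$, and let $\succeq$ be the domination relations with ng-relaxation $\mathcal N$ defined in the context. Then: (i) Let $s_1,s_2$ be admissible partial subpaths with $s_1\succeq s_2$, and let $a\in\mathcal A$ be an arc extending both. If $s_2\oplus a$ is admissible, then $s_1\oplus a$ is admissible and $s_1\oplus a\succeq s_2\oplus a$. (ii) Let $p_1,p_2$ be admissible partial paths with $p_1\succeq p_2$, and let $s$ be an admissible subpath extending both. If $p_2\oplus s$ is admissible, then $p_1\oplus s$ is admissible and $p_1\oplus s\succeq p_2\oplus s$. (iii) Let $s_1,s_2$ be admissible subpaths with $s_1\succeq s_2$, both extending an admissible partial path $p$. If $p\oplus s_2$ is admissible, then $p\oplus s_1$ is admissible and $p\oplus s_1\succeq p\oplus s_2$.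
   Context: **Instance.** $(\mathcal V,\mathcal A)$ is a finite directed graph, $\mathcal V=\mathcal V_C\cup\mathcal V_D\cup\mathcal V_S$ a partition into customers, depots and charging stations; $T$ is the time horizon, $B$ the battery capacity, $D$ the vehicle capacity. Each arc $(i,j)$ has travel time $t_{i,j}>0$, cost $c_{i,j}>0$, battery use $b_{i,j}>0$. Each node $i$ has demand $d_i\ge 0$ and time window $[\alpha_i,\beta_i]\subseteq[0,T]$; for $i\in\mathcal V_D\cup\mathcal V_S$, $d_i=0$, $\alpha_i=0$, $\beta_i=T$. The charging function $g:\mathbb R_+\to[0,B]$ is concave, increasing, $g(0)=0$, and invertible: it is continuous, strictly increasing until it attains $B$, and $g^{-1}(b)$ is the smallest $t$ with $g(t)=b$. Set $g_T(b_1,b_2)=g^{-1}(b_2)-g^{-1}(b_1)$ and $g_C(b,t)=g(g^{-1}(b)+t)$. **Modified costs.** Given real vectors $\kappa,\mu$ (indexed by $\mathcal V_D$) and $\nu$ (indexed by $\mathcal V_C$), $\overline c_{i,j}=c_{i,j}-\mathbb 1(i\in\mathcal V_D)\kappa_i-\mathbb 1(j\in\mathcal V_D)\mu_j-\mathbb 1(j\in\mathcal V_C)\nu_j$. **ng-neighborhood.** A collection $\mathcal N=\{N_i\subseteq\mathcal V: i\in\mathcal V\}$ with $i\in N_i$ for all $i$; $N_i\subseteq\mathcal V_C$ for $i\in\mathcal V_C$; $N_i\subseteq\mathcal V_C\cup\{i\}$ for $i\in\mathcal V_D\cup\mathcal V_S$. A node sequence $(n_0,\dots,n_m)$ is ng-feasible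 if for every $j<k$ with $n_j=n_k$ there is $j<\ell<k$ with $n_j\notin N_{n_\ell}$; a (partial) path or subpath is ng-feasible if its node sequence is. For a node sequence $N=(n_0,\dots,n_m)$: forward ng-set $\Pi(N)=\{n_r: n_r\in\bigcap_{\rho=r+1}^mN_{n_\rho},\ 0\le r\le m-1\}\cup\{n_m\}$; backward ng-set $\Pi^{-1}(N)=\{n_0\}\cup\{n_r: n_r\in\bigcap_{\rho=0}^{r-1}N_{n_\rho},\ 1\le r\le m\}$; ng-residue $\Omega(N)=\bigcap_{\rho=0}^mN_{n_\rho}$. **Subpaths.** A partial subpath $s$ is a node sequence $(n_0,\dots,n_m)$ along arcs with $n_0\in\mathcal V_D\cup\mathcal V_S$ and $n_1,\dots,n_{m-1}\in\mathcal V_C$; it is a subpath if moreover $n_m\in\mathcal V_D\cup\mathcal V_S$. It is feasible if there is $(t_0,b_0)$ such that, with $t_{k+1}=\max\{t_k+t_{n_k,n_{k+1}},\alpha_{n_{k+1}}\}$ and $b_{k+1}=b_k-b_{n_k,n_{k+1}}$, one has $\sum_k d_{n_k}\le D$, $b_k\in[0,B]$, $t_k\in[\alpha_{n_k},\beta_{n_k}]$ for all $k$. An arc $a=(n_m,n')$ extends $s$ to $s\oplus a$. Resources: $\overline c(s)=\sum_\ell\overline c_{n_\ell,n_{\ell+1}}$; $B(s)=\sum_\ell b_{n_\ell,n_{\ell+1}}$; $D(s)=\sum_{\ell=0}^m d_{n_\ell}$; $T^{\rm travel}(s)=\sum_\ell t_{n_\ell,n_{\ell+1}}$; $T^{\rm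 end}_{\min}(s)=T^E_m$ with $T^E_0=\alpha_{n_0}$, $T^E_{\ell+1}=\max\{T^E_\ell+t_{n_\ell,n_{\ell+1}},\alpha_{n_{\ell+1}}\}$; $T^{\rm start}_{\max}(s)=T^L_0$ with $T^L_m=\beta_{n_m}$, $T^L_\ell=\min\{T^L_{\ell+1}-t_{n_\ell,n_{\ell+1}},\beta_{n_\ell}\}$; $Q(s)=\max\{T^{\rm travel}(s),T^{\rm end}_{\min}(s)-T^{\rm start}_{\max}(s)\}$. Subpath domination: for admissible partial subpaths with the same start and end nodes, $s_1\succeq s_2$ iff $\overline c(s_1)\le\overline c(s_2)$, $D(s_1)\le D(s_2)$, $B(s_1)\le B(s_2)$, $T^{\rm end}_{\min}(s_1)\le T^{\rm end}_{\min}(s_2)$, $T^{\rm start}_{\max}(s_1)\ge T^{\rm start}_{\max}(s_2)$, $Q(s_1)\le Q(s_2)$, and additionally $\Pi(s_1)\subseteq\Pi(s_2)$, $\Pi^{-1}(s_1)\subseteq\Pi^{-1}(s_2)$, $\Omega(s_1)\subseteq\Omega(s_2)$. **Paths.** A partial path $p$ is a node sequence $(n_0,\dots,n_m)$ along arcs with $n_0\in\mathcal V_D$ and $n_1,\dots,n_{m-1}\in\mathcal V_C\cup\mathcal V_S$. It is feasible if there are charging times $\tau_k\ge0$ ($n_k\in\mathcal V_S$; put $\tau_k=0$ otherwise) such that with $t_0=0$, $b_0=B$, $t_{k+1}=\max\{t_k+\tau_k+t_{n_k,n_{k+1}},\alpha_{n_{k+1}}\}$, and $b_{k+1}=g_C(b_k,\tau_k)-b_{n_k,n_{k+1}}$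 if $n_k\in\mathcal V_S$, $b_{k+1}=b_k-b_{n_k,n_{k+1}}$ otherwise, one has $\sum_k d_{n_k}\le D$, $b_k\in[0,B]$, $t_k\in[\alpha_{n_k},\beta_{n_k}]$ for all $k$. Partial paths considered here end at non-customer nodes and are concatenations $p=(s_1,\dots,s_m)$ of subpaths (or a single depot node). A subpath $s$ extends $p$ if the end node of $p$ equals the start node of $s$ and is in $\mathcal V_S$ (or $p$ is the single depot node at which $s$ starts); the concatenation (shared node counted once) is $p\oplus s$. Resources: $\overline c(p)$ (sum of $\overline c_{i,j}$ over arcs); $D(p)$ (total load); $T^{\rm end}_{\min}(p)$, the minimum of $T^{\rm end}_m$ subject to $T^{\rm start}_1=0$; $T^{\rm start}_k\le T^{\rm start}_{\max}(s_k)$; $T^{\rm end}_m\le T$; $T^{\rm start}_{k+1}=T^{\rm end}_k+\tau_k$; $T^{\rm end}_k=\max\{T^{\rm start}_k+T^{\rm travel}(s_k),T^{\rm end}_{\min}(s_k)\}$; $B^{\rm start}_1=B$; $B^{\rm end}_k=B^{\rm start}_k-B(s_k)$; $B^{\rm start}_{k+1}=g_C(B^{\rm end}_k,\tau_k)$; all variables nonnegative; and $B^{\rm end}_{\max}(p)$, the maximum of $B^{\rm end}_m$ under the same constraints plus $T^{\rm end}_m=T^{\rm end}_{\min}(p)$. (Single depot node: $0,0,0,B$.) Path domination: for admissible partial paths with the same start and end nodes, $p_1\succeq p_2$ iff $\overline c(p_1)\le\overline c(p_2)$, $D(p_1)\le D(p_2)$, $T^{\rm end}_{\min}(p_1)+g_T(B^{\rm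 end}_{\max}(p_1),\max\{B^{\rm end}_{\max}(p_1),B^{\rm end}_{\max}(p_2)\})\le T^{\rm end}_{\min}(p_2)$, and additionally $\Pi(p_1)\subseteq\Pi(p_2)$. *)

(* Defs.v *)
From HB Require Import structures.
From mathcomp Require Import all_boot all_order all_algebra.
From mathcomp Require Import all_classical all_reals all_analysis.

Set Implicit Arguments.
Unset Strict Implicit.
Unset Printing Implicit Defensive.

Import Order.TTheory GRing.Theory Num.Theory.
Import numFieldNormedType.Exports.

Local Open Scope ring_scope.

(* Only the restriction of [g] to the nonnegative reals is meaningful;
   [ch_onto] makes "strictly increasing until it attains B" literal, so that
   the inverse is defined on all of [0, B]. *)
Record charging_function (R : realType) (B : R) (g : R -> R) : Prop := {
  ch_range : forall x : R, 0 <= x -> 0 <= g x <= B;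
  ch_zero : g 0 = 0;
  ch_concave : convex_function (`[0, +oo[%classic : set R^o) (fun x => - g x);
  ch_continuous : {within `[0, +oo[, continuous g}%classic;
  ch_mono : forall x y : R, 0 <= x -> x <= y -> g x <= g y;
  ch_strict : forall x y : R, 0 <= x -> x < y -> g x < B -> g x < g y;
  ch_onto : exists2 x : R, 0 <= x & g x = B
}.

(* Arc data are total functions on pairs of nodes, used only along arcs. *)
Record instance (R : realType) (V : finType) := Instance {
  edge : rel V;
  customers : {set V};
  depots : {set V};
  stations : {set V};
  horizon : R;
  battery : R;
  capacity : R;
  time : V -> V -> R;
  cost : V -> V -> R;
  energy : V -> V -> R;
  demand : V -> R;
  tw_open : V -> R;
  tw_close : V -> R;
  charging : R -> R;
  nodes_cover : (customers :|: depots :|: stations)%SET = [set: V]%SET;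
  nodes_disjoint : [/\ [disjoint customers & depots],
    [disjoint customers & stations] & [disjoint depots & stations]];
  time_gt0 : forall i j, edge i j -> 0 < time i j;
  cost_gt0 : forall i j, edge i j -> 0 < cost i j;
  energy_gt0 : forall i j, edge i j -> 0 < energy i j;
  demand_ge0 : forall i, 0 <= demand i;
  tw_bounds : forall i,
    [/\ 0 <= tw_open i, tw_open i <= tw_close i & tw_close i <= horizon];
  noncustomer_data : forall i, i \in (depots :|: stations)%SET ->
    [/\ demand i = 0, tw_open i = 0 & tw_close i = horizon];
  charge_ok : charging_function battery charging
}.

Section Charging.
Context {R : realType} {V : finType} (I : instance R V).

(* For 0 <= b <= battery the set is nonempty and closed by continuity, so the
   infimum is the smallest solution. *)
Definition charge_inv (b : R) : R :=
  inf [set x | 0 <= x /\ charging I x = b]%classic.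

Definition g_T (b1 b2 : R) : R := charge_inv b2 - charge_inv b1.

Definition g_C (b x : R) : R := charging I (charge_inv b + x).

End Charging.

(* Nonempty node sequence (n_0, ..., n_m), with m = len and n_k = s k
   (out-of-range indices give n_0). *)
Record nodeseq (V : finType) := NodeSeq { first : V; rest : seq V }.

Definition len (V : finType) (s : nodeseq V) : nat := size (rest s).

Definition node (V : finType) (s : nodeseq V) (k : nat) : V :=
  nth (first s) (first s :: rest s) k.

Coercion node : nodeseq >-> Funclass.

Definition final (V : finType) (s : nodeseq V) : V := s (len s).

Definition add_arc (V : finType) (s : nodeseq V) (a : V * V) : nodeseq V :=
  NodeSeq (first s) (rcons (rest s) a.2).

(* Meant for [final p = first s]; the shared node is kept once. *)
Definition concat (V : finType) (p s : nodeseq V) : nodeseq V :=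
  NodeSeq (first p) (rest p ++ rest s).

Section NgSets.
Context {R : realType} {V : finType} (I : instance R V) (N : V -> {set V}).

Definition ng_neighborhood : Prop :=
  [/\ forall i, i \in N i,
      forall i, i \in customers I -> N i \subset customers I
    & forall i, i \in (depots I :|: stations I)%SET ->
        N i \subset (i |: customers I)%SET].

Definition ng_feasible (s : nodeseq V) : Prop :=
  forall j k, (j < k)%N -> (k <= len s)%N -> s j = s k ->
  exists l, [/\ (j < l)%N, (l < k)%N & s j \notin N (s l)].

Definition ng_forward (s : nodeseq V) : {set V} :=
  ([set s r | r : 'I_(len s)
      & s r \in \bigcap_(r.+1 <= rho < (len s).+1) N (s rho)]
   :|: [set final s])%SET.

Definition ng_backward (s : nodeseq V) : {set V} :=
  ([set first s] :|: [set s r | r : 'I_(len s).+1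
      & (0 < r)%N && (s r \in \bigcap_(0 <= rho < r) N (s rho))])%SET.

Definition ng_residue (s : nodeseq V) : {set V} :=
  (\bigcap_(0 <= rho < (len s).+1) N (s rho))%SET.

End NgSets.

Section Resources.
Context {R : realType} {V : finType} (I : instance R V).

Definition arc_sum (f : V -> V -> R) (s : nodeseq V) : R :=
  \sum_(0 <= k < len s) f (s k) (s k.+1).

Definition load (s : nodeseq V) : R :=
  \sum_(0 <= k < (len s).+1) demand I (s k).

(* [kappa] and [mu] are read only on depots, [nu] only on customers. *)
Definition reduced_cost (kappa mu nu : V -> R) (i j : V) : R :=
  cost I i j - (if i \in depots I then kappa i else 0)
             - (if j \in depots I then mu j else 0)
             - (if j \in customers I then nu j else 0).

Definition travel_time : nodeseq V -> R := arc_sum (time I).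

Definition energy_use : nodeseq V -> R := arc_sum (energy I).

Fixpoint sub_time (s : nodeseq V) (t0 : R) (k : nat) : R :=
  if k is l.+1 then
    Num.max (sub_time s t0 l + time I (s l) (s l.+1)) (tw_open I (s l.+1))
  else t0.

Fixpoint sub_battery (s : nodeseq V) (b0 : R) (k : nat) : R :=
  if k is l.+1 then sub_battery s b0 l - energy I (s l) (s l.+1) else b0.

Definition end_min (s : nodeseq V) : R :=
  sub_time s (tw_open I (first s)) (len s).

(* Latest admissible departure from [x] when the nodes [l] remain. *)
Fixpoint latest (x : V) (l : seq V) : R :=
  if l is y :: l' then Num.min (latest y l' - time I x y) (tw_close I x)
  else tw_close I x.

Definition start_max (s : nodeseq V) : R := latest (first s) (rest s).

Definition min_duration (s : nodeseq V) : R :=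
  Num.max (travel_time s) (end_min s - start_max s).

End Resources.

Section Subpaths.
Context {R : realType} {V : finType} (I : instance R V).

Definition partial_subpath (s : nodeseq V) : Prop :=
  [/\ path (edge I) (first s) (rest s),
      first s \in (depots I :|: stations I)%SET
    & forall k, (0 < k < len s)%N -> s k \in customers I].

Definition subpath (s : nodeseq V) : Prop :=
  partial_subpath s /\ final s \in (depots I :|: stations I)%SET.

Definition sub_feasible (s : nodeseq V) : Prop :=
  exists t0 b0 : R,
    load I s <= capacity I /\
    forall k, (k <= len s)%N ->
      0 <= sub_battery I s b0 k <= battery I /\
      tw_open I (s k) <= sub_time I s t0 k <= tw_close I (s k).

Definition admissible_partial_subpath (N : V -> {set V}) (s : nodeseq V) :=
  [/\ partial_subpath s, sub_feasible s & ng_feasible N s].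

Definition admissible_subpath (N : V -> {set V}) (s : nodeseq V) :=
  [/\ subpath s, sub_feasible s & ng_feasible N s].

Record sub_dominates (kappa mu nu : V -> R) (N : V -> {set V})
    (s1 s2 : nodeseq V) : Prop := {
  sd_first : first s1 = first s2;
  sd_final : final s1 = final s2;
  sd_cost : arc_sum (reduced_cost I kappa mu nu) s1
            <= arc_sum (reduced_cost I kappa mu nu) s2;
  sd_load : load I s1 <= load I s2;
  sd_energy : energy_use I s1 <= energy_use I s2;
  sd_end : end_min I s1 <= end_min I s2;
  sd_start : start_max I s2 <= start_max I s1;
  sd_duration : min_duration I s1 <= min_duration I s2;
  sd_forward : ng_forward N s1 \subset ng_forward N s2;
  sd_backward : ng_backward N s1 \subset ng_backward N s2;
  sd_residue : ng_residue N s1 \subset ng_residue N s2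
}.

End Subpaths.

Section Paths.
Context {R : realType} {V : finType} (I : instance R V).

Definition partial_path (p : nodeseq V) : Prop :=
  [/\ path (edge I) (first p) (rest p),
      first p \in depots I,
      forall k, (0 < k < len p)%N ->
        p k \in (customers I :|: stations I)%SET
    & final p \in (depots I :|: stations I)%SET].

Fixpoint path_time (p : nodeseq V) (tau : nat -> R) (k : nat) : R :=
  if k is l.+1 then
    Num.max (path_time p tau l + tau l + time I (p l) (p l.+1))
            (tw_open I (p l.+1))
  else 0.

Fixpoint path_battery (p : nodeseq V) (tau : nat -> R) (k : nat) : R :=
  if k is l.+1 then
    (if p l \in stations I then g_C I (path_battery p tau l) (tau l)
     else path_battery p tau l) - energy I (p l) (p l.+1)
  else battery I.

Definition path_feasible (p : nodeseq V) : Prop :=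
  exists tau : nat -> R,
    [/\ forall k, (k <= len p)%N ->
          0 <= tau k /\ (p k \notin stations I -> tau k = 0),
        load I p <= capacity I
      & forall k, (k <= len p)%N ->
          0 <= path_battery p tau k <= battery I /\
          tw_open I (p k) <= path_time p tau k <= tw_close I (p k)].

Definition admissible_path (N : V -> {set V}) (p : nodeseq V) :=
  [/\ partial_path p, path_feasible p & ng_feasible N p].

(* [cut x acc l] cuts the sequence (x, acc, l) after every non-customer node
   of [l], where [acc] collects the customers visited since [x]. *)
Fixpoint cut (x : V) (acc l : seq V) : seq (nodeseq V) :=
  match l with
  | [::] => if acc is [::] then [::] else [:: NodeSeq x acc]
  | y :: l' => if y \in customers I then cut x (rcons acc y) l'
               else NodeSeq x (rcons acc y) :: cut y [::] l'
  end.

(* The unique decomposition of a partial path into subpaths having at least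
   one arc; it is empty for a single depot node. *)
Definition subpaths (p : nodeseq V) : seq (nodeseq V) :=
  cut (first p) [::] (rest p).

Lemma subpathsK (p : nodeseq V) :
  flatten [seq rest s | s <- subpaths p] = rest p.
Proof.
rewrite /subpaths; suff H l x acc :
  flatten [seq rest s | s <- cut x acc l] = acc ++ l by rewrite H.
elim: l x acc => [|y l IH] x acc /=; first by case: acc => //= a s; rewrite cats0.
by case: ifP => _; rewrite /= IH ?cat_rcons.
Qed.

(* Constraints of the resource problem over consecutive subpaths
   s_0, ..., s_{m-1}, where [Ts], [Te], [Bs], [Be] are the times and battery
   levels at the start and end of each subpath and [tau k] is the charging time
   between s_k and s_{k+1}. *)
Record schedule (p : nodeseq V) (Ts Te Bs Be tau : nat -> R) : Prop := {
  sch_nonneg : forall k, (k < size (subpaths p))%N ->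
    [/\ 0 <= Ts k, 0 <= Te k, 0 <= Bs k & 0 <= Be k];
  sch_charge : forall k, (k.+1 < size (subpaths p))%N -> 0 <= tau k;
  sch_start0 : Ts 0%N = 0;
  sch_battery0 : Bs 0%N = battery I;
  sch_latest : forall k, (k < size (subpaths p))%N ->
    Ts k <= start_max I (nth p (subpaths p) k);
  sch_horizon : Te (size (subpaths p)).-1 <= horizon I;
  sch_end : forall k, (k < size (subpaths p))%N ->
    Te k = Num.max (Ts k + travel_time I (nth p (subpaths p) k))
                   (end_min I (nth p (subpaths p) k));
  sch_energy : forall k, (k < size (subpaths p))%N ->
    Be k = Bs k - energy_use I (nth p (subpaths p) k);
  sch_start : forall k, (k.+1 < size (subpaths p))%N ->
    Ts k.+1 = Te k + tau k;
  sch_recharge : forall k, (k.+1 < size (subpaths p))%N ->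
    Bs k.+1 = g_C I (Be k) (tau k)
}.

(* For a feasible partial path both extrema below are attained. *)
Definition path_end_min (p : nodeseq V) : R :=
  if len p == 0%N then 0 else
  inf [set u | exists Ts Te Bs Be tau, schedule p Ts Te Bs Be tau /\
                 u = Te (size (subpaths p)).-1]%classic.

Definition path_battery_max (p : nodeseq V) : R :=
  if len p == 0%N then battery I else
  sup [set b | exists Ts Te Bs Be tau, [/\ schedule p Ts Te Bs Be tau,
                 Te (size (subpaths p)).-1 = path_end_min p
               & b = Be (size (subpaths p)).-1]]%classic.

Definition extends_path (s p : nodeseq V) : Prop :=
  final p = first s /\ (final p \in stations I \/ len p = 0%N).

Record path_dominates (kappa mu nu : V -> R) (N : V -> {set V})
    (p1 p2 : nodeseq V) : Prop := {
  pd_first : first p1 = first p2;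
  pd_final : final p1 = final p2;
  pd_cost : arc_sum (reduced_cost I kappa mu nu) p1
            <= arc_sum (reduced_cost I kappa mu nu) p2;
  pd_load : load I p1 <= load I p2;
  pd_time : path_end_min p1
            + g_T I (path_battery_max p1)
                (Num.max (path_battery_max p1) (path_battery_max p2))
            <= path_end_min p2;
  pd_forward : ng_forward N p1 \subset ng_forward N p2
}.

End Paths.

(* Main.v *)
Require Import Defs.
From mathcomp Require Import all_boot all_order all_algebra.
From mathcomp Require Import all_classical all_reals all_analysis.
From mathcomp Require Import lra zify.

Set Implicit Arguments.
Unset Strict Implicit.
Unset Printing Implicit Defensive.

Import Order.TTheory GRing.Theory Num.Theory.
Import numFieldNormedType.Exports.

Local Open Scope ring_scope.

(** The ng-conditions and the additive resources are settled by describing them on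
    a concatenation. For instance, [concat p s] is ng-feasible iff [p] and [s] are
    and the forward ng-set of [p] meets the backward ng-set of [s] at most in the
    shared node ([ng_feasible_concat]), a condition that survives when either set
    shrinks.

    For a subpath, a departure at [d] meets all time windows iff the earliest
    schedule does and [d] is at most [start_max], and the end time is then the
    maximum of [d + travel_time] and [end_min]. Extending by an arc may lower
    [start_max] more when the travel time is larger; domination in duration says
    that either the travel time does not increase, or it is bounded by the gap
    between latest start and earliest end of the dominated subpath, and in both
    cases the required inequalities follow ([sub_extension]).

    For paths, consider the pairs (time, battery level) that can be reached at the
    end, and let the level of a battery state be the time [charge_inv] needed to
    charge up to it. Say that a pair dominates another one if it is no later and if
    its level minus its time is no smaller; this is exactly the time condition in
    the domination of paths ([state_dom_g_T]). The reachable pairs of [concat p s]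
    are obtained from those of [p] by charging and traversing [s], whether one
    looks at the path node by node ([path_state_concat]) or through the
    optimization problem over subpaths ([sched_state_concat]). This transition is
    monotone: the dominating vehicle charges until the other one departs
    ([leg_dom_start]). From a given pair it has a best outcome, since by concavity
    any charge that delays the end is better postponed until after the subpath
    ([leg_best]). By induction every feasible path has a best reachable pair, and
    this pair is (minimal end time, maximal battery level) ([path_best]). Domination
    of paths thus means domination of every reachable pair by a reachable pair,
    and it is preserved by the transition. Replacing the last subpath by a
    dominating one, with the same departure time, ends no later and with at least
    as much energy ([leg_dom_subpath]). *)

(** * The charging function *)

Section ChargingTheory.
Context {R : realType} {V : finType} (I : instance R V).
Local Notation g := (charging I).
Local Notation B := (battery I).
Local Notation level := (charge_inv I).

Lemma charging_range x : 0 <= x -> 0 <= g x <= B.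
Proof. exact: ch_range (charge_ok I) x. Qed.

Lemma charging_mono x y : 0 <= x -> x <= y -> g x <= g y.
Proof. exact: ch_mono (charge_ok I) x y. Qed.

Lemma battery_ge0 : 0 <= B.
Proof. by have /andP[/le_trans] := charging_range (lexx 0); apply. Qed.

(** Intermediate value property of the charging function. *)
Lemma charging_ivt x y v : 0 <= x -> x <= y -> g x <= v <= g y ->
  exists2 c, x <= c <= y & g c = v.
Proof.
move=> x0 xy gv; have gxy := charging_mono x0 xy.
have [||c] := @IVT R g x y v xy.
- apply: continuous_subspaceW (ch_continuous (charge_ok I)) => z /=.
  by rewrite !in_itv /= andbT => /andP[xz _]; exact: le_trans xz.
- by rewrite min_l // max_r.
- by rewrite in_itv /= => ? ?; exists c.
Qed.

(** The infimum defining [level b], the time needed to charge from [0] to [b],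
    is attained. *)
Lemma charge_invK b : 0 <= b <= B -> 0 <= level b /\ g (level b) = b.
Proof.
move=> /andP[b0 bB].
pose S := [set x | 0 <= x /\ g x = b]%classic.
have lbS : has_lbound S by exists 0 => x [].
have [xB xB0 gxB] := ch_onto (charge_ok I).
have [x1 x1P] : S !=set0%classic.
  have [|c /andP[c0 _] gc] := charging_ivt (v := b) (lexx 0) xB0; last by exists c.
  by rewrite (ch_zero (charge_ok I)) b0 gxB.
rewrite -/(level b); have inf0 : 0 <= level b.
  by apply: lb_le_inf; [exists x1 | move=> x []].
have infS x : S x -> level b <= x by exact: ge_inf lbS x.
split=> //; apply/eqP; rewrite eq_le; have gle : g (level b) <= b.
  by case: (x1P) => _ {2}<-; apply: charging_mono inf0 (infS _ x1P).
rewrite gle leNgt; apply/negP => glt.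
(* Halfway between [g (level b)] and [b] the value is reached at a point that
   is a lower bound of the solutions, hence at [level b] itself. *)
have [c /andP[lec _] gc] : exists2 c, level b <= c <= x1 &
    g c = (g (level b) + b) / 2.
  apply: charging_ivt inf0 (infS _ x1P) _.
  by case: (x1P) => _ gx1; rewrite gx1; apply/andP; split; lra.
have cinf : c <= level b.
  apply: lb_le_inf; first by exists x1.
  move=> y [y0 gy]; rewrite leNgt; apply/negP => /ltW yc.
  by have := charging_mono y0 yc; rewrite gc gy; lra.
have ce : c = level b by apply/eqP; rewrite eq_le cinf.
by move: gc; rewrite ce; lra.
Qed.

Lemma charge_inv_ge0 b : 0 <= b <= B -> 0 <= level b.
Proof. by case/charge_invK. Qed.

Lemma charging_level b : 0 <= b <= B -> g (level b) = b.
Proof. by case/charge_invK. Qed.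

(** The level and the charging function form a Galois connection. *)
Lemma charge_inv_le b x : 0 <= b <= B -> 0 <= x -> (level b <= x) = (b <= g x).
Proof.
move=> bB x0; have [l0 gl] := charge_invK bB; apply/idP/idP => [lx|bg].
  by rewrite -{1}gl; exact: charging_mono.
rewrite leNgt; apply/negP => xl.
have gxb : g x = b.
  by apply/eqP; rewrite eq_le bg andbT -{1}gl; exact: charging_mono x0 (ltW xl).
suff : level b <= x by rewrite leNgt xl.
by apply: ge_inf; [exists 0 => y [] | split].
Qed.

Lemma charge_inv_mono b1 b2 : 0 <= b1 <= B -> 0 <= b2 <= B ->
  (level b1 <= level b2) = (b1 <= b2).
Proof.
by move=> h1 h2; rewrite charge_inv_le ?charging_level ?charge_inv_ge0.
Qed.

Lemma g_C_range b x : 0 <= b <= B -> 0 <= x -> 0 <= g_C I b x <= B.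
Proof. by move=> bB x0; apply/charging_range/addr_ge0/x0/charge_inv_ge0. Qed.

Lemma g_C0 b : 0 <= b <= B -> g_C I b 0 = b.
Proof. by move=> bB; rewrite /g_C addr0 charging_level. Qed.

Lemma g_C_battery x : 0 <= x -> g_C I B x = B.
Proof.
move=> x0; have BB : 0 <= B <= B by rewrite battery_ge0 lexx.
have /andP[_ le] := g_C_range BB x0.
apply/eqP; rewrite eq_le le /g_C -{1}(charging_level BB) /=.
by apply: charging_mono; rewrite ?charge_inv_ge0 // lerDl.
Qed.

(** By concavity, charging during [d] gains less from a higher level. *)
Lemma charging_increment z w d : 0 <= z -> z <= w -> 0 <= d ->
  g (w + d) - g w <= g (z + d) - g z.
Proof.
move=> z0 zw d0; have [->|wz] := eqVneq w z; first by [].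
have L0 : 0 < w + d - z by rewrite subr_gt0 ltr_wpDr // lt_neqAle eq_sym wz.
pose u := d / (w + d - z).
have u0 : 0 <= u by rewrite /u divr_ge0 // ltW.
have u1 : u <= 1 by rewrite /u ler_pdivrMr // mul1r; lra.
have uL : u * (w + d - z) = d by rewrite /u divfK // gt_eqF.
have zin : z \in (`[0, +oo[%classic : set R) by rewrite inE /= in_itv /= andbT.
have wdin : w + d \in (`[0, +oo[%classic : set R).
  by rewrite inE /= in_itv /= andbT; lra.
have conv := ch_concave (charge_ok I) (Itv01 u0 u1).
have c1 : - g (u * z + (1 - u) * (w + d)) <= u * - g z + (1 - u) * - g (w + d).
  exact: conv z (w + d) zin wdin.
have c2 : - g (u * (w + d) + (1 - u) * z) <= u * - g (w + d) + (1 - u) * - g z.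
  exact: conv (w + d) z wdin zin.
have e1 : u * z + (1 - u) * (w + d) = w by lra.
have e2 : u * (w + d) + (1 - u) * z = z + d by lra.
by move: c1 c2; rewrite e1 e2; lra.
Qed.

End ChargingTheory.

(** * Concatenation of node sequences and ng-sets *)

Section Concatenation.
Context {V : finType}.
Implicit Types p s : nodeseq V.

Lemma final_last p : final p = last (first p) (rest p).
Proof. by rewrite /final /node /len -[size _]/(size (first p :: rest p)).-1 nth_last. Qed.

Lemma len_concat p s : len (concat p s) = (len p + len s)%N.
Proof. exact: size_cat. Qed.

Lemma concat_nodel p s k : (k <= len p)%N -> concat p s k = p k.
Proof. by move=> kp; rewrite /node /= -cat_cons nth_cat /= ltnS kp. Qed.

Lemma concat_noder p s k : final p = first s -> (k <= len s)%N ->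
  concat p s (len p + k)%N = s k.
Proof.
move=> ps; case: k => [|k] ks; first by rewrite addn0 concat_nodel.
rewrite /node /= -cat_cons nth_cat /= addnS ltnS ltnNge leq_addr /= subSS.
by rewrite -/(len p) addKn; exact: set_nth_default.
Qed.

Lemma final_concat p s : final p = first s -> final (concat p s) = final s.
Proof. by move=> ps; rewrite /final len_concat concat_noder. Qed.

Lemma concat_len0 p s : len s = 0%N -> concat p s = p.
Proof. by case: p s => [x l] [y m] /size0nil /= ->; rewrite /concat /= cats0. Qed.

Lemma add_arc_concat p (a : V * V) : add_arc p a = concat p (NodeSeq a.1 [:: a.2]).
Proof. by rewrite /add_arc /concat /= cats1. Qed.

Lemma path_concat (e : rel V) p s : final p = first s ->
  path e (first (concat p s)) (rest (concat p s)) =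
  path e (first p) (rest p) && path e (first s) (rest s).
Proof. by move=> ps; rewrite /= cat_path -final_last ps. Qed.

Lemma path_node (e : rel V) s k : path e (first s) (rest s) -> (k < len s)%N ->
  e (s k) (s k.+1).
Proof. by move=> /(pathP (first s)) es ks; exact: es. Qed.

End Concatenation.

Arguments concat_nodel {V} p s {k}.

Section NgTheory.
Context {V : finType} (N : V -> {set V}).
Implicit Types p s : nodeseq V.

Lemma mem_bigcap_nat (F : nat -> {set V}) x m n :
  x \in (\bigcap_(m <= i < n) F i)%SET <-> forall i, (m <= i < n)%N -> x \in F i.
Proof.
have -> : (x \in (\bigcap_(m <= i < n) F i)%SET) =
    all (fun i => x \in F i) (index_iota m n).
  by elim: (index_iota m n) => [|i r IH]; rewrite ?big_nil ?big_cons !inE ?IH.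
split=> [/allP xF i|xF]; first by rewrite -mem_index_iota => /xF.
by apply/allP => i; rewrite mem_index_iota => /xF.
Qed.

Lemma ng_forwardP x s : x \in ng_forward N s <->
  exists r, [/\ (r <= len s)%N, s r = x &
    forall l, (r < l <= len s)%N -> x \in N (s l)].
Proof.
rewrite /ng_forward finset.in_setU finset.in_set1; split.
  case/orP => [/imsetP[r]|/eqP->].
    rewrite inE /= => /mem_bigcap_nat rN ->; exists r; split=> //; exact: ltnW.
  by exists (len s); split=> // l /andP[/leq_trans h /h]; rewrite ltnn.
case=> r [rs <- rN]; move: rs; rewrite leq_eqVlt => /predU1P[->|rs].
  by rewrite eqxx orbT.
apply/orP; left; apply/imsetP; exists (Ordinal rs) => //=.
by rewrite inE /=; apply/mem_bigcap_nat.
Qed.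

Lemma ng_backwardP x s : x \in ng_backward N s <->
  exists r, [/\ (r <= len s)%N, s r = x &
    forall l, (l < r)%N -> x \in N (s l)].
Proof.
rewrite /ng_backward finset.in_setU finset.in_set1; split.
  case/orP => [/eqP->|/imsetP[r]]; first by exists 0%N.
  rewrite inE /= => /andP[_ /mem_bigcap_nat rN] ->; exists r.
  by split=> [||l lr]; rewrite ?rN // -ltnS.
case=> r [rs <- rN]; case: (posnP r) => [->|r0]; first by rewrite eqxx.
apply/orP; right; apply/imsetP; exists (Ordinal (rs : (r < (len s).+1)%N)) => //=.
by rewrite inE /= r0; apply/mem_bigcap_nat => l /andP[_] /rN.
Qed.

Lemma ng_residueP x s : x \in ng_residue N s <->
  forall l, (l <= len s)%N -> x \in N (s l).
Proof.
rewrite /ng_residue; split=> [/mem_bigcap_nat xN l ls|xN]; first exact: xN.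
by apply/mem_bigcap_nat => l; rewrite ltnS => /xN.
Qed.

Lemma ng_feasibleP s : ng_feasible N s <->
  forall j k, (j < k <= len s)%N -> s j = s k ->
    ~ (forall l, (j < l < k)%N -> s j \in N (s l)).
Proof.
split=> [ngs j k /andP[jk ks] sjk jN | ngs j k jk ks sjk].
  by have [l [jl lk /negP[]]] := ngs j k jk ks sjk; apply: jN; rewrite jl.
apply: contra_notP (ngs j k _ sjk) => [H l /andP[jl lk]|]; last by rewrite jk.
by apply: contra_notT H => lN; exists l.
Qed.

Section Concat.
Context (p s : nodeseq V) (ps : final p = first s).

Lemma ng_forward_concat x : x \in ng_forward N (concat p s) <->
  x \in ng_forward N s \/ x \in ng_forward N p /\ x \in ng_residue N s.
Proof.
rewrite !ng_forwardP ng_residueP len_concat; split.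
  case=> r [rle rx rN]; have [pr|rp] := leqP (len p) r.
    left; exists (r - len p)%N; split; first by lia.
      by rewrite -(concat_noder ps) ?subnKC //; lia.
    by move=> l lr; rewrite -(concat_noder ps) ?rN //; lia.
  right; split.
    exists r; split; [exact: ltnW | by rewrite -(concat_nodel _ s) // ltnW|].
    by move=> l lr; rewrite -(concat_nodel _ s) ?rN //; lia.
  by move=> l ls; rewrite -(concat_noder ps) ?rN //; lia.
case=> [[r [rs rx rN]]|[[r [rp rx rN]] sN]].
  exists (len p + r)%N; split; [by rewrite leq_add2l | by rewrite concat_noder|].
  move=> l lr; have -> : l = (len p + (l - len p))%N by lia.
  by rewrite concat_noder ?rN //; lia.
exists r; split; [by lia | by rewrite concat_nodel|].
move=> l lr; have [lp|pl] := leqP l (len p).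
  by rewrite concat_nodel ?rN //; lia.
have -> : l = (len p + (l - len p))%N by lia.
by rewrite concat_noder ?sN //; lia.
Qed.

Lemma ng_backward_concat x : x \in ng_backward N (concat p s) <->
  x \in ng_backward N p \/ x \in ng_residue N p /\ x \in ng_backward N s.
Proof.
rewrite !ng_backwardP ng_residueP len_concat; split.
  case=> r [rle rx rN]; have [rp|pr] := leqP r (len p).
    left; exists r; split=> //; first by rewrite -(concat_nodel _ s).
    by move=> l lr; rewrite -(concat_nodel _ s) ?rN //; lia.
  right; split.
    by move=> l lp; rewrite -(concat_nodel _ s) ?rN //; lia.
  exists (r - len p)%N; split; first by lia.
    by rewrite -(concat_noder ps) ?subnKC //; lia.
  by move=> l lr; rewrite -(concat_noder ps) ?rN //; lia.
case=> [[r [rp rx rN]]|[pN [r [rs rx rN]]]].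
  exists r; split; [by lia | by rewrite concat_nodel|].
  by move=> l lr; rewrite concat_nodel ?rN //; lia.
exists (len p + r)%N; split; [by rewrite leq_add2l | by rewrite concat_noder|].
move=> l lr; have [lp|pl] := leqP l (len p); first by rewrite concat_nodel ?pN.
have -> : l = (len p + (l - len p))%N by lia.
by rewrite concat_noder ?rN //; lia.
Qed.

Lemma ng_residue_concat x : x \in ng_residue N (concat p s) <->
  x \in ng_residue N p /\ x \in ng_residue N s.
Proof.
rewrite !ng_residueP len_concat; split=> [xN|[pN sN] l lps].
  split=> l ls; first by rewrite -(concat_nodel _ s) ?xN //; lia.
  by rewrite -(concat_noder ps) ?xN //; lia.
have [lp|pl] := leqP l (len p); first by rewrite concat_nodel ?pN.
have -> : l = (len p + (l - len p))%N by lia.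
by rewrite concat_noder ?sN //; lia.
Qed.

(** A violation of ng-feasibility across the junction is a node, other than
    the shared one, that lies in both the forward ng-set of [p] and the backward
    ng-set of [s]. *)
Lemma ng_feasible_concat : ng_feasible N (concat p s) <->
  [/\ ng_feasible N p, ng_feasible N s &
    forall x, x \in ng_forward N p -> x \in ng_backward N s -> x = final p].
Proof.
rewrite ng_feasibleP len_concat; split.
  move=> ng; split.
  - apply/ng_feasibleP => j k jk pjk jN; apply: (ng j k); first by lia.
      by rewrite !concat_nodel //; lia.
    by move=> l lr; rewrite !concat_nodel ?jN //; lia.
  - apply/ng_feasibleP => j k jk sjk jN.
    apply: (ng (len p + j)%N (len p + k)%N); first by lia.
      by rewrite !concat_noder //; lia.
    move=> l lr; have -> : l = (len p + (l - len p))%N by lia.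
    by rewrite !concat_noder ?jN //; lia.
  - move=> x /ng_forwardP[j [jp jx jN]] /ng_backwardP[k [ks kx kN]].
    have [jk|] := ltnP j (len p + k); last first.
      by move=> jk; rewrite -jx /final; congr (p _); lia.
    case: (ng j (len p + k)%N); first by lia.
      by rewrite concat_nodel // concat_noder // jx.
    rewrite concat_nodel // jx => l lr; have [lp|pl] := leqP l (len p).
      by rewrite concat_nodel ?jN //; lia.
    have -> : l = (len p + (l - len p))%N by lia.
    by rewrite concat_noder ?kN //; lia.
case=> /ng_feasibleP ngp /ng_feasibleP ngs cross j k /andP[jk kps] jkE jN.
have [kp|pk] := leqP k (len p).
  have jp : (j <= len p)%N by lia.
  apply: (ngp j k); [by rewrite jk | by move: jkE; rewrite !concat_nodel|].
  by move=> l lr; have := jN l lr; rewrite !concat_nodel //; lia.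
have kE : k = (len p + (k - len p))%N by lia.
have [pj|jp] := leqP (len p) j.
  have jE : j = (len p + (j - len p))%N by lia.
  have js : concat p s j = s (j - len p)%N by rewrite {1}jE concat_noder //; lia.
  apply: (ngs (j - len p)%N (k - len p)%N); first by lia.
    by rewrite -js jkE [in LHS]kE concat_noder //; lia.
  move=> l lr; have := jN (len p + l)%N; rewrite js concat_noder //; last by lia.
  by apply; lia.
have jl : concat p s j = p j by rewrite concat_nodel // ltnW.
have pjF : p j = final p.
  apply: cross.
    apply/ng_forwardP; exists j; split=> //; first exact: ltnW.
    by move=> l lr; have := jN l; rewrite jl concat_nodel; [apply|]; lia.
  apply/ng_backwardP; exists (k - len p)%N; split; first by lia.
    by rewrite -jl jkE [in RHS]kE concat_noder //; lia.
  move=> l lr; have := jN (len p + l)%N; rewrite jl concat_noder //; last by lia.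
  by apply; lia.
apply: (ngp j (len p)); [by rewrite jp leqnn | exact: pjF |].
by move=> l lr; have := jN l; rewrite jl concat_nodel; [apply|]; lia.
Qed.
End Concat.

End NgTheory.

(** * Resources of subpaths *)

Section ResourceTheory.
Context {R : realType} {V : finType} (I : instance R V).
Implicit Types p s : nodeseq V.

Lemma arc_sum_concat (f : V -> V -> R) p s : final p = first s ->
  arc_sum f (concat p s) = arc_sum f p + arc_sum f s.
Proof.
move=> ps; rewrite /arc_sum len_concat (@big_cat_nat _ _ _ (len p)) //=; last by lia.
congr (_ + _).
  by apply: eq_big_nat => k kp; rewrite !concat_nodel //; lia.
rewrite -{1}[len p]add0n big_addn addKn; apply: eq_big_nat => k ks.
by rewrite addnC -addnS !concat_noder //; lia.
Qed.

Lemma arc_sum_ge0 (f : V -> V -> R) s :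
  (forall i j, edge I i j -> 0 < f i j) -> path (edge I) (first s) (rest s) ->
  0 <= arc_sum f s.
Proof.
move=> f0 es; rewrite /arc_sum big_nat; apply: sumr_ge0 => k ks.
by apply/ltW/f0/path_node.
Qed.

Lemma arc_sum_gt0 (f : V -> V -> R) s :
  (forall i j, edge I i j -> 0 < f i j) -> path (edge I) (first s) (rest s) ->
  (0 < len s)%N -> 0 < arc_sum f s.
Proof.
move=> f0 es ls; rewrite /arc_sum big_nat big_ltn_cond // ls /=.
by apply: ltr_pwDl;
  [exact/f0/path_node | apply: sumr_ge0 => k ks; apply/ltW/f0/path_node].
Qed.

Lemma energy_use_ge0 s : path (edge I) (first s) (rest s) -> 0 <= energy_use I s.
Proof. exact/arc_sum_ge0/energy_gt0. Qed.

Lemma travel_time_ge0 s : path (edge I) (first s) (rest s) -> 0 <= travel_time I s.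
Proof. exact/arc_sum_ge0/time_gt0. Qed.

Lemma load_concat p s : final p = first s ->
  load I (concat p s) = load I p + (load I s - demand I (first s)).
Proof.
move=> ps; rewrite /load len_concat (@big_cat_nat _ _ _ (len p).+1) //=; last by lia.
congr (_ + _).
  by apply: eq_big_nat => k kp; rewrite !concat_nodel //; lia.
rewrite [in RHS]big_nat_recl //= addrC addrA addNr add0r.
rewrite -{1}[(len p).+1]add0n big_addn subSS addKn; apply: eq_big_nat => k ks.
by rewrite addnS addnC -addnS concat_noder //; lia.
Qed.

(** Travel time from the first node to node [k]. *)
Definition elapsed s k : R := \sum_(0 <= i < k) time I (s i) (s i.+1).

Lemma elapsedS s k : elapsed s k.+1 = elapsed s k + time I (s k) (s k.+1).
Proof. by rewrite /elapsed big_nat_recr. Qed.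

Lemma elapsed_concatr p s k : final p = first s -> (k <= len s)%N ->
  elapsed (concat p s) (len p + k) = travel_time I p + elapsed s k.
Proof.
move=> ps ks; rewrite /elapsed (@big_cat_nat _ _ _ (len p)) //=; last by lia.
congr (_ + _).
  by apply: eq_big_nat => i ip; rewrite !concat_nodel //; lia.
rewrite -{1}[len p]add0n big_addn addKn; apply: eq_big_nat => i ik.
by rewrite addnC -addnS !concat_noder //; lia.
Qed.

Lemma elapsed_concatl p s k : (k <= len p)%N -> elapsed (concat p s) k = elapsed p k.
Proof.
by move=> kp; apply: eq_big_nat => i ip; rewrite !concat_nodel //; lia.
Qed.

(** The backward recursion computes the latest departure that meets the closing
    times when there is no waiting. *)
Lemma start_maxP d s : d <= start_max I s <->
  forall k, (k <= len s)%N -> d + elapsed s k <= tw_close I (s k).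
Proof.
case: s => x l; rewrite /start_max /len /=.
elim: l x d => [|y l IH] x d /=.
  split=> [dx [|//] _|/(_ 0%N)]; first by rewrite /elapsed big_nil addr0.
  by rewrite /elapsed big_nil addr0; apply.
have nS k : (k <= size l)%N -> NodeSeq x (y :: l) k.+1 = NodeSeq y l k.
  by move=> kl; apply: set_nth_default.
have eS k : (k <= size l)%N ->
    elapsed (NodeSeq x (y :: l)) k.+1 = time I x y + elapsed (NodeSeq y l) k.
  move=> kl; rewrite /elapsed big_nat_recl //; congr (_ + _).
  by apply: eq_big_nat => i ik; rewrite !nS //; lia.
rewrite le_min lerBrDr; split.
  move=> /andP[/IH dl dx] [_|k kl]; first by rewrite /elapsed big_nil addr0.
  by rewrite eS // nS // addrA; exact: dl.
move=> H; apply/andP; split; last by have := H 0%N; rewrite /elapsed big_nil addr0; apply.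
by apply/IH => k kl; have := H k.+1 kl; rewrite eS // nS // addrA.
Qed.

Lemma start_max_close s : start_max I s <= tw_close I (first s).
Proof.
have /start_maxP/(_ 0%N isT) := lexx (start_max I s).
by rewrite /elapsed big_nil addr0.
Qed.

Lemma start_max_concat p s : final p = first s ->
  start_max I (concat p s) = Num.min (start_max I p) (start_max I s - travel_time I p).
Proof.
move=> ps; have E d : (d <= start_max I (concat p s)) =
    (d <= Num.min (start_max I p) (start_max I s - travel_time I p)).
  rewrite le_min lerBrDr; apply/idP/andP.
    move/start_maxP; rewrite len_concat => H; split; apply/start_maxP => k kl.
      have := H k; rewrite elapsed_concatl // concat_nodel //; apply; lia.
    have := H (len p + k)%N; rewrite elapsed_concatr // concat_noder // addrA.
    by apply; lia.
  case=> /start_maxP Hp /start_maxP Hs; apply/start_maxP => k; rewrite len_concat => kl.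
  have [kp|pk] := leqP k (len p); first by rewrite elapsed_concatl ?concat_nodel ?Hp.
  have -> : k = (len p + (k - len p))%N by lia.
  by rewrite elapsed_concatr ?concat_noder ?addrA ?Hs //; lia.
by apply/eqP; rewrite eq_le -E lexx E lexx.
Qed.

(** Departing at [d] rather than as early as possible delays node [k] only
    through the travel time. *)
Lemma sub_timeE s d k : tw_open I (first s) <= d ->
  sub_time I s d k =
  Num.max (d + elapsed s k) (sub_time I s (tw_open I (first s)) k).
Proof.
move=> od; elim: k => [|k IH] /=; first by rewrite /elapsed big_nil addr0 max_l.
by rewrite IH elapsedS addr_maxl addrA -maxA.
Qed.

Lemma sub_time_mono s d d' k : d <= d' -> sub_time I s d k <= sub_time I s d' k.
Proof. by move=> dd; elim: k => //= k IH; rewrite le_max2 // lerD2r. Qed.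

Lemma sub_time_open s d k : tw_open I (first s) <= d ->
  tw_open I (s k) <= sub_time I s d k.
Proof. by case: k => //= k _; rewrite le_max lexx orbT. Qed.

Lemma eq_sub_time p s d k : (forall i, (i <= k)%N -> p i = s i) ->
  sub_time I p d k = sub_time I s d k.
Proof.
elim: k => //= k IH H; rewrite IH ?H // => i ik.
by apply: H; rewrite ltnW.
Qed.

Lemma sub_time_concatr p s d k : final p = first s -> (k <= len s)%N ->
  sub_time I (concat p s) d (len p + k) = sub_time I s (sub_time I p d (len p)) k.
Proof.
move=> ps; elim: k => [|k IH] ks.
  by rewrite addn0; apply: eq_sub_time => i ip; rewrite concat_nodel.
by rewrite addnS /= IH 1?ltnW // -addnS !concat_noder // ltnW.
Qed.

Lemma sub_batteryE s b k :
  sub_battery I s b k = b - \sum_(0 <= i < k) energy I (s i) (s i.+1).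
Proof.
elim: k => [|k IH] /=; first by rewrite big_nil subr0.
by rewrite big_nat_recr //= IH opprD addrA.
Qed.

Lemma sub_battery_bounds s b k : path (edge I) (first s) (rest s) ->
  (k <= len s)%N -> b - energy_use I s <= sub_battery I s b k <= b.
Proof.
move=> es ks; have e0 i : (i < len s)%N -> 0 <= energy I (s i) (s i.+1).
  by move=> ls; apply/ltW/energy_gt0/path_node.
rewrite sub_batteryE /energy_use /arc_sum (@big_cat_nat _ _ _ k 0 (len s)) //=.
rewrite lerD2l lerN2 lerDl gerBl !big_nat.
by apply/andP; split; apply: sumr_ge0 => i ik; apply: e0; lia.
Qed.

(** The time windows are met when departing as early as possible. *)
Definition in_windows s : Prop := forall k, (k <= len s)%N ->
  sub_time I s (tw_open I (first s)) k <= tw_close I (s k).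

(** A subpath is feasible iff it is so when started as early as possible with a
    full battery. *)
Lemma sub_feasibleP s : path (edge I) (first s) (rest s) ->
  sub_feasible I s <->
  [/\ load I s <= capacity I, energy_use I s <= battery I & in_windows s].
Proof.
move=> es; split.
  case=> t0 [b0 [ld H]]; split=> //.
    have [] := H _ (leqnn _); rewrite sub_batteryE -/(energy_use I s) => /andP[be _] _.
    by have [/andP[_ /(le_trans _)]] := H 0%N isT => + _; apply; rewrite -subr_ge0.
  move=> k ks; have [_ /andP[_]] := H k ks; apply: le_trans.
  by apply: sub_time_mono; have [_ /andP[]] := H 0%N isT.
case=> ld en win; exists (tw_open I (first s)), (battery I); split=> // k ks; split.
  have /andP[lo ->] := sub_battery_bounds (battery I) es ks.
  by rewrite (le_trans _ lo) // subr_ge0.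
by rewrite sub_time_open ?win.
Qed.

Lemma end_min_close s : in_windows s -> end_min I s <= tw_close I (final s).
Proof. by move/(_ (len s)); apply. Qed.

Lemma nodes_split i : i \in (customers I :|: depots I :|: stations I)%SET.
Proof. by rewrite nodes_cover inE. Qed.

Lemma noncustomerE i : (i \in (depots I :|: stations I)%SET) = (i \notin customers I).
Proof.
have [cd cs _] := nodes_disjoint I; have := nodes_split i.
rewrite -finset.setUA finset.in_setU; case: (boolP (i \in customers I)) => //= iC _.
by rewrite finset.in_setU (disjointFr cd iC) (disjointFr cs iC).
Qed.

Lemma depot_not_station i : i \in depots I -> i \notin stations I.
Proof. by have [_ _ ds] := nodes_disjoint I => /(disjointFr ds) ->. Qed.

Lemma depot_noncustomer i : i \in depots I -> i \in (depots I :|: stations I)%SET.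
Proof. by move=> iD; rewrite finset.in_setU iD. Qed.

Lemma open_noncustomer i : i \in (depots I :|: stations I)%SET -> tw_open I i = 0.
Proof. by case/(@noncustomer_data _ _ I). Qed.

Lemma close_noncustomer i : i \in (depots I :|: stations I)%SET ->
  tw_close I i = horizon I.
Proof. by case/(@noncustomer_data _ _ I). Qed.

End ResourceTheory.

(** * Extending a partial subpath by an arc *)

Section SubpathExtension.
Context {R : realType} {V : finType} (I : instance R V) (N : V -> {set V}).
Implicit Types p s : nodeseq V.

(** The node sequence of a single arc; extending by an arc is concatenating with
    it. *)
Definition arc_seq (a : V * V) : nodeseq V := NodeSeq a.1 [:: a.2].

Lemma arc_sum_arc (f : V -> V -> R) a : arc_sum f (arc_seq a) = f a.1 a.2.
Proof. by rewrite /arc_sum big_nat1. Qed.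

Lemma end_min_arc s a : final s = a.1 ->
  end_min I (concat s (arc_seq a)) =
  Num.max (end_min I s + time I a.1 a.2) (tw_open I a.2).
Proof.
by move=> sa; rewrite /end_min len_concat (@sub_time_concatr _ _ _ s (arc_seq a) _ 1).
Qed.

Lemma start_max_arc s a : final s = a.1 ->
  start_max I (concat s (arc_seq a)) =
  Num.min (start_max I s) (tw_close I a.2 - time I a.1 a.2 - travel_time I s).
Proof.
move=> sa; rewrite start_max_concat // {2}/start_max /=.
rewrite [X in X - travel_time I s]minC addr_minl minA; congr (Num.min _ _).
rewrite min_l // lerBrDr -sa.
by have /start_maxP := lexx (start_max I s); apply.
Qed.

Lemma in_windows_arc s a : final s = a.1 ->
  in_windows I (concat s (arc_seq a)) <->
  in_windows I s /\ end_min I (concat s (arc_seq a)) <= tw_close I a.2.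
Proof.
move=> sa; set u := arc_seq a; split.
  move=> win; split; last by have := end_min_close win; rewrite final_concat.
  move=> k ks; have := win k; rewrite len_concat concat_nodel //.
  rewrite (@eq_sub_time _ _ _ _ s); first by apply; lia.
  by move=> i ik; rewrite concat_nodel //; lia.
case=> win wina k; rewrite len_concat addn1 leq_eqVlt ltnS => /predU1P[->|ks].
  have -> : concat s u (len s).+1 = a.2.
    by rewrite -[(len s).+1]addn1 (concat_noder (s := u)).
  by move: wina; rewrite /end_min len_concat addn1.
rewrite concat_nodel // (@eq_sub_time _ _ _ _ s); first exact: win.
by move=> i ik; rewrite concat_nodel //; lia.
Qed.

(** A loop cannot dominate a single node, because it uses energy. *)
Lemma sub_dominates_len kappa mu nu s1 s2 :
  path (edge I) (first s1) (rest s1) ->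
  sub_dominates I kappa mu nu N s1 s2 -> (0 < len s1)%N -> (0 < len s2)%N.
Proof.
move=> e1 dom l1; rewrite lt0n; apply/eqP => l2.
have := arc_sum_gt0 (@energy_gt0 _ _ I) e1 l1.
rewrite ltNge => /negP; apply; apply: le_trans (sd_energy dom) _.
by rewrite /energy_use /arc_sum l2 big_nil.
Qed.

(** Domination of partial subpaths is preserved by extension along an arc. *)
Lemma sub_extension kappa mu nu s1 s2 a :
  admissible_partial_subpath I N s1 -> admissible_partial_subpath I N s2 ->
  sub_dominates I kappa mu nu N s1 s2 ->
  edge I a.1 a.2 -> a.1 = final s1 -> a.1 = final s2 ->
  admissible_partial_subpath I N (concat s2 (arc_seq a)) ->
  admissible_partial_subpath I N (concat s1 (arc_seq a)) /\
  sub_dominates I kappa mu nu N (concat s1 (arc_seq a)) (concat s2 (arc_seq a)).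
Proof.
set u := arc_seq a.
move=> [[e1 f1 c1] feas1 ng1] [[e2 f2 c2] feas2 ng2] dom ea fa1 fa2.
case=> [[e2u _ c2u] feas2u ng2u].
have fin1 : final s1 = first u by rewrite -fa1.
have fin2 : final s2 = first u by rewrite -fa2.
have eu : path (edge I) (first u) (rest u) by rewrite /= ea.
have e1u : path (edge I) (first (concat s1 u)) (rest (concat s1 u)).
  by rewrite path_concat // e1.
have [ld2 en2 win2] := (sub_feasibleP e2u).1 feas2u.
have [_ en1 win1] := (sub_feasibleP e1).1 feas1.
have {}win2 := ((in_windows_arc fin2).1 win2).2.
have end12 : end_min I (concat s1 u) <= end_min I (concat s2 u).
  by rewrite !end_min_arc // le_max2 // lerD2r (sd_end dom).
have load12 : load I (concat s1 u) <= load I (concat s2 u).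
  by rewrite !load_concat // lerD2r (sd_load dom).
have energy12 : energy_use I (concat s1 u) <= energy_use I (concat s2 u).
  by rewrite /energy_use !arc_sum_concat // lerD2r (sd_energy dom).
(* The bound on durations: either the travel time does not increase, or it fits
   between the latest start and the earliest end of [s2]. *)
have time12 : travel_time I s1 <= travel_time I s2 \/
    travel_time I s1 <= end_min I s2 - start_max I s2.
  have := sd_duration dom; rewrite /min_duration ge_max le_max => /andP[/orP + _].
  by [].
have arc2 : end_min I s2 + time I a.1 a.2 <= tw_close I a.2.
  by apply: le_trans win2; rewrite end_min_arc // le_max lexx.
have start12 : start_max I (concat s2 u) <= start_max I (concat s1 u).
  have := sd_start dom; rewrite !start_max_arc // le_min !ge_min => ->/=.
  by apply/orP; case: time12 => h; [right|left]; lra.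
split; last split.
- split.
  + split=> // k; rewrite len_concat addn1 ltnS => /andP[k0 kl].
    have [kl'|] := ltnP k (len s1); first by rewrite concat_nodel // c1 // k0.
    move=> kl'; have -> : k = len s1 by apply/eqP; rewrite eqn_leq kl.
    (* The shared end node is a customer, being interior in the extension of
       [s2]. *)
    have l2 : (0 < len s2)%N by apply: sub_dominates_len e1 dom (leq_trans k0 kl).
    rewrite concat_nodel // -/(final s1) -fa1 fa2 /final -(concat_nodel _ u) //.
    by apply: c2u; rewrite len_concat l2 addn1 ltnS leqnn.
  + apply/(sub_feasibleP e1u); split.
    * exact: le_trans load12 ld2.
    * exact: le_trans energy12 en2.
    * by apply/in_windows_arc => //; split=> //; exact: le_trans end12 win2.
  + have [_ ngu cross] := (ng_feasible_concat N fin2).1 ng2u.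
    apply/ng_feasible_concat => //; split=> // x x1 xu.
    by rewrite -fa1 fa2; exact: cross (fintype.subsetP (sd_forward dom) _ x1) xu.
- exact: sd_first dom.
- by rewrite !final_concat.
- by rewrite !arc_sum_concat // lerD2r (sd_cost dom).
- exact: load12.
- exact: energy12.
- exact: end12.
- exact: start12.
- have := sd_duration dom; rewrite /min_duration.
  have -> : travel_time I (concat s1 u) = travel_time I s1 + time I a.1 a.2.
    by rewrite /travel_time arc_sum_concat // arc_sum_arc.
  have -> : travel_time I (concat s2 u) = travel_time I s2 + time I a.1 a.2.
    by rewrite /travel_time arc_sum_concat // arc_sum_arc.
  have ge2 : end_min I s2 + time I a.1 a.2 <= end_min I (concat s2 u).
    by rewrite end_min_arc // le_max lexx.
  have le2 : start_max I (concat s2 u) <= start_max I s2.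
    by rewrite start_max_arc // ge_min lexx.
  move=> _; rewrite ge_max !le_max; apply/andP; split; apply/orP.
    by case: time12 => h; [left|right]; lra.
  by right; lra.
- apply/fintype.subsetP => x /(ng_forward_concat N fin1) h.
  apply/(ng_forward_concat N fin2); case: h => [|[x1 xu]]; first by left.
  by right; split=> //; exact: (fintype.subsetP (sd_forward dom) _ x1).
- apply/fintype.subsetP => x /(ng_backward_concat N fin1) h.
  apply/(ng_backward_concat N fin2); case: h => [x1|[x1 xu]].
    by left; exact: (fintype.subsetP (sd_backward dom) _ x1).
  by right; split=> //; exact: (fintype.subsetP (sd_residue dom) _ x1).
- apply/fintype.subsetP => x /(ng_residue_concat N fin1)[x1 xu].
  by apply/(ng_residue_concat N fin2); split=> //;
    exact: (fintype.subsetP (sd_residue dom) _ x1).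
Qed.

End SubpathExtension.

(** * Decomposing a path into subpaths *)

Section PathDecomposition.
Context {R : realType} {V : finType} (I : instance R V).
Implicit Types p s : nodeseq V.

Lemma partial_path_noncustomer p : partial_path I p ->
  final p \in (depots I :|: stations I)%SET.
Proof. by case. Qed.

Lemma subpath_path s : subpath I s -> path (edge I) (first s) (rest s).
Proof. by case=> [[]]. Qed.

Lemma subpath_first s : subpath I s -> first s \in (depots I :|: stations I)%SET.
Proof. by case=> [[]]. Qed.

Lemma concat_partial_path p s : partial_path I p -> subpath I s ->
  extends_path I s p -> partial_path I (concat p s).
Proof.
move=> [ep fp cp lp] [[es fs cs] ls] [ps st].
split=> //; last by rewrite final_concat.
  by rewrite path_concat // ep.
move=> k; rewrite len_concat => /andP[k0 kl].
have [kp|pk|kp] := ltngtP k (len p).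
- by rewrite concat_nodel 1?ltnW // cp // k0.
- have kE : k = (len p + (k - len p))%N by rewrite subnKC // ltnW.
  rewrite kE concat_noder // ?finset.in_setU ?cs //.
    by rewrite subn_gt0 pk ltn_subLR // ltnW.
  by rewrite leq_subLR ltnW.
- rewrite kp concat_nodel //.
  case: st => [st|p0]; first by rewrite finset.in_setU -/(final p) st orbT.
  by rewrite kp p0 in k0.
Qed.

(** Every partial path is obtained from its first depot by appending subpaths
    one at a time: the last one starts at the last non-customer node before the
    end. *)
Lemma partial_path_ind (P : nodeseq V -> Prop) :
  (forall p, partial_path I p -> len p = 0%N -> P p) ->
  (forall p s, partial_path I p -> subpath I s -> (0 < len s)%N ->
     extends_path I s p -> P p -> P (concat p s)) ->
  forall p, partial_path I p -> P p.
Proof.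
move=> P0 PS p; have [n] := ubnP (len p); elim: n p => // n IH p pn pp.
have [p0|p0] := posnP (len p); first exact: P0.
have [ep fp cp lp] := pp.
pose Q k := (k < len p)%N && (p k \notin customers I).
have Q0 : exists k, Q k by exists 0%N; rewrite /Q p0 -noncustomerE depot_noncustomer.
have Qle k : Q k -> (k <= len p)%N by case/andP => /ltnW.
case: (ex_maxnP Q0 Qle) => k /andP[kp kC] kmax.
pose p' := NodeSeq (first p) (take k (rest p)).
pose s := NodeSeq (p k) (drop k (rest p)).
have pE : p = concat p' s.
  by rewrite /concat /= cat_take_drop; case: (p).
have lp' : len p' = k by rewrite /len /= size_takel // ltnW.
have ls : len s = (len p - k)%N by rewrite /len /= size_drop.
have nE i : (i <= k)%N -> p' i = p i by move=> ik; rewrite [p in RHS]pE concat_nodel ?lp'.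
have ps : final p' = first s by rewrite /final lp' nE.
have sE i : (i <= len s)%N -> s i = p (k + i)%N.
  by move=> is_; rewrite [p in RHS]pE -{1}lp' concat_noder.
have [ep' es] : path (edge I) (first p') (rest p') /\ path (edge I) (first s) (rest s).
  by apply/andP; rewrite -path_concat // -pE.
have finp' : final p' \in (depots I :|: stations I)%SET.
  by rewrite /final lp' nE // noncustomerE.
have pp' : partial_path I p'.
  split=> // i; rewrite lp' => /andP[i0 ik]; rewrite nE ?(ltnW ik) // cp // i0.
  exact: ltn_trans kp.
have ss : subpath I s.
  split; last by rewrite /final sE // ls subnKC // ltnW.
  split=> //; first by rewrite -ps.
  move=> i /andP[i0 il]; rewrite sE 1?ltnW //; apply: contraT => iC.
  have : Q (k + i)%N by rewrite /Q iC andbT -ltn_subRL -ls.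
  by move=> /kmax; rewrite -{2}[k]addn0 leq_add2l leqNgt i0.
have ext : extends_path I s p'.
  split=> //; rewrite lp'; have [->|k0] := posnP k; [by right | left].
  have : p k \in (customers I :|: stations I)%SET by rewrite cp // k0.
  by rewrite finset.in_setU (negPf kC) /= /final lp' nE.
rewrite pE; apply: PS => //; first by rewrite ls subn_gt0.
by apply: IH => //; rewrite lp'; apply: leq_trans kp _.
Qed.

Lemma subpaths_size_eq0 p : (size (subpaths I p) == 0%N) = (len p == 0%N).
Proof.
apply/eqP/eqP => [/size0nil sp|/size0nil rp]; last by rewrite /subpaths rp.
by rewrite /len -(subpathsK I) sp.
Qed.

Lemma cut_cons x acc y l : Defs.cut I x acc (y :: l) =
  if y \in customers I then Defs.cut I x (rcons acc y) l
  else NodeSeq x (rcons acc y) :: Defs.cut I y [::] l.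
Proof. by []. Qed.

Lemma cut_cat x acc y l1 l2 : last y l1 \notin customers I ->
  Defs.cut I x acc (y :: l1 ++ l2) =
  Defs.cut I x acc (y :: l1) ++ Defs.cut I (last y l1) [::] l2.
Proof.
elim: l1 x acc y => [|z l1 IH] x acc y lC; first by rewrite !cut_cons (negPf lC).
by rewrite 2!(cut_cons _ acc) !cat_cons !IH //; case: ifP.
Qed.

Lemma cut_subpath x acc l y : all [in customers I] l -> y \notin customers I ->
  Defs.cut I x acc (rcons l y) = [:: NodeSeq x (acc ++ rcons l y)].
Proof.
elim: l x acc => [|z l IH] x acc /=; first by move=> _ /negPf ->; rewrite cats1.
by move=> /andP[zC lC] yC; rewrite zC IH // cat_rcons.
Qed.

Lemma subpaths_concat p s : partial_path I p -> subpath I s -> (0 < len s)%N ->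
  final p = first s -> subpaths I (concat p s) = rcons (subpaths I p) s.
Proof.
move=> pp ss ls ps.
have sE : Defs.cut I (first s) [::] (rest s) = [:: s].
  case: ss ls => [[_ _ cs] fs]; case: s ps cs fs => x; case/lastP => // l y _ cs fs _.
  rewrite cut_subpath //; last first.
    by rewrite -noncustomerE; move: fs; rewrite final_last /= last_rcons.
  apply/allP => z /(nthP x)[i il <-].
  have := cs i.+1; rewrite /len /= size_rcons /node /= nth_rcons il; apply.
  by rewrite ltnS.
have := partial_path_noncustomer pp; rewrite noncustomerE final_last.
rewrite /subpaths -cats1 -[in RHS]sE -ps final_last /=.
by case: (rest p) => // y l lC; exact: cut_cat.
Qed.

End PathDecomposition.

(** * States reached node by node *)

Section Reachability.
Context {R : realType} {V : finType} (I : instance R V).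
Implicit Types (p s : nodeseq V) (q : R * R).
Local Notation B := (battery I).

(** A state is a pair of an arrival time and a battery level. [leg s q tau q']
    says that from state [q] at the first node of [s], charging during [tau] and
    then traversing [s] leads to state [q'] at its end. Outside stations the only
    charging time is [0], and [g_C] then leaves the battery unchanged. *)
Definition leg s q tau q' : Prop :=
  [/\ 0 <= tau, first s \notin stations I -> tau = 0,
      q.1 + tau <= start_max I s, energy_use I s <= g_C I q.2 tau &
      q' = (Num.max (q.1 + tau + travel_time I s) (end_min I s),
            g_C I q.2 tau - energy_use I s)].

(** States that can be reached at the end of [p], by the node-by-node
    recursion. *)
Definition path_state p q : Prop := exists tau : nat -> R,
  [/\ forall k, (k <= len p)%N -> 0 <= tau k /\ (p k \notin stations I -> tau k = 0),
      forall k, (k <= len p)%N ->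
        0 <= path_battery I p tau k <= B /\
        tw_open I (p k) <= path_time I p tau k <= tw_close I (p k) &
      q = (path_time I p tau (len p), path_battery I p tau (len p))].

(** States that can be reached at the end of [p], by the subpath-by-subpath
    resource problem; a single node gives the initial state. *)
Definition sched_state p q : Prop :=
  if len p == 0%N then q = (0, B) else
  exists Ts Te Bs Be tau, schedule I p Ts Te Bs Be tau /\
    q = (Te (size (subpaths I p)).-1, Be (size (subpaths I p)).-1).

Lemma path_feasibleP p : path_feasible I p <->
  load I p <= capacity I /\ exists q, path_state p q.
Proof.
split=> [[tau [tau0 ld win]]|[ld [q [tau [tau0 win _]]]]]; last by exists tau.
by split=> //; exists (path_time I p tau (len p), path_battery I p tau (len p)), tau.
Qed.

Lemma path_state_bounds p q : path_state p q -> 0 <= q.1 /\ 0 <= q.2 <= B.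
Proof.
case=> tau [_ /(_ _ (leqnn _))[bB /andP[ot _]] ->]; split=> //=.
by have [op _ _] := tw_bounds I (p (len p)); exact: le_trans ot.
Qed.

Lemma path_state0 p : partial_path I p -> len p = 0%N -> forall q,
  path_state p q <-> q = (0, B).
Proof.
move=> [_ fp _ _] p0 q; rewrite /path_state p0; split; first by case=> tau [].
move=> ->; exists (fun=> 0); split=> // k; rewrite leqn0 => /eqP-> /=.
rewrite battery_ge0 lexx /node /= open_noncustomer ?depot_noncustomer //.
by have [op oc _] := tw_bounds I (first p); rewrite lexx (le_trans op oc).
Qed.

Lemma eq_path_time p p' tau tau' k : (forall i, (i <= k)%N -> p i = p' i) ->
  (forall i, (i < k)%N -> tau i = tau' i) ->
  path_time I p tau k = path_time I p' tau' k.
Proof.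
elim: k => //= k IH ep et; rewrite IH ?ep ?et //.
- by move=> i ik; rewrite ep // ltnW.
- by move=> i ik; rewrite et // ltnW.
Qed.

Lemma eq_path_battery p p' tau tau' k : (forall i, (i <= k)%N -> p i = p' i) ->
  (forall i, (i < k)%N -> tau i = tau' i) ->
  path_battery I p tau k = path_battery I p' tau' k.
Proof.
elim: k => //= k IH ep et; rewrite IH ?ep ?et //.
- by move=> i ik; rewrite ep // ltnW.
- by move=> i ik; rewrite et // ltnW.
Qed.

Lemma subpath_customer s k : subpath I s -> (0 < k < len s)%N ->
  s k \notin stations I.
Proof.
case=> [[_ _ cs] _] /cs sC; have [_ cS _] := nodes_disjoint I.
by rewrite (disjointFr cS sC).
Qed.

Section Concat.
Context (p s : nodeseq V) (pp : partial_path I p) (ss : subpath I s).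
Context (ls : (0 < len s)%N) (ext : extends_path I s p).

Let ps : final p = first s. Proof. by case: ext. Qed.

Lemma extends_station : (0 < len p)%N -> first s \in stations I.
Proof. by rewrite -ps; case: ext => _ [//|->]. Qed.

Lemma extends_depot : len p = 0%N -> first s \notin stations I.
Proof.
move=> p0; rewrite -ps /final p0; case: pp => _ fp _ _.
exact: depot_not_station fp.
Qed.

(** Past the junction, the recursion over [concat p s] is the recursion over
    [s] started at the departure from the junction. *)
Lemma path_state_tail tau k
    (q := (path_time I p tau (len p), path_battery I p tau (len p))) :
  (forall j, (0 < j < len s)%N -> tau (len p + j)%N = 0) ->
  0 <= tau (len p) ->
  (0 < k <= len s)%N ->
  path_time I (concat p s) tau (len p + k) = sub_time I s (q.1 + tau (len p)) k /\
  path_battery I (concat p s) tau (len p + k) =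
    sub_battery I s (g_C I q.2 (tau (len p))) k.
Proof.
move=> tau0 taup; case: k => // k /=; elim: k => [|k IH] kls.
  rewrite addn1 /= -addn1 (concat_noder ps ls) concat_nodel //.
  rewrite (@eq_path_time _ p tau tau); [|by move=> i ip; rewrite concat_nodel|by []].
  rewrite (@eq_path_battery _ p tau tau); [|by move=> i ip; rewrite concat_nodel|by []].
  rewrite -/(final p) ps; split=> //; congr (_ - _).
  case: ifP => // st; have [p0|/extends_station] := posnP (len p); last by rewrite st.
  by rewrite p0 /= g_C_battery // -p0.
have [IHt IHb] := IH (ltnW kls).
rewrite addnS /= IHt IHb -addnS !(concat_noder ps) ?(ltnW kls) //.
by rewrite tau0 ?kls // addr0 (negPf (subpath_customer ss _)) // kls.
Qed.

Lemma path_state_concat q' : path_state (concat p s) q' <->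
  in_windows I s /\ exists q tau, path_state p q /\ leg s q tau q'.
Proof.
have op0 : tw_open I (first s) = 0 by apply/open_noncustomer/subpath_first.
split.
  case=> tau [tauP win qE]; rewrite len_concat in tauP win qE.
  pose q := (path_time I p tau (len p), path_battery I p tau (len p)).
  have [taup taus] := tauP (len p) (leq_addr _ _).
  have nodep k : (k <= len p)%N -> concat p s k = p k by exact: concat_nodel.
  have timep k : (k <= len p)%N ->
      path_time I (concat p s) tau k = path_time I p tau k.
    by move=> kp; apply: eq_path_time => // i ik; rewrite nodep // (leq_trans ik).
  have batp k : (k <= len p)%N ->
      path_battery I (concat p s) tau k = path_battery I p tau k.
    by move=> kp; apply: eq_path_battery => // i ik; rewrite nodep // (leq_trans ik).
  have pq : path_state p q.
    exists tau; split=> // k kp; have kps := leq_trans kp (leq_addr (len s) (len p)).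
      by have := tauP k kps; rewrite nodep.
    by have := win k kps; rewrite nodep // timep // batp.
  have tau0 j : (0 < j < len s)%N -> tau (len p + j)%N = 0.
    move=> js; have jle : (j <= len s)%N by case/andP: js => _ /ltnW.
    have [_] := tauP (len p + j)%N (leq_add (leqnn _) jle).
    by apply; rewrite (concat_noder ps) // subpath_customer.
  have tl := path_state_tail tau0 taup.
  set d := q.1 + tau (len p); have [q0 qB] := path_state_bounds pq.
  have d0 : tw_open I (first s) <= d by rewrite op0 addr_ge0.
  have wins k : (0 < k <= len s)%N -> sub_time I s d k <= tw_close I (s k).
    move=> ks; have [<- _] := tl k ks; have [_ kl] := andP ks.
    by have [_ /andP[_]] := win (len p + k)%N (leq_add (leqnn _) kl);
      rewrite (concat_noder ps).
  have le_wins k : (0 < k <= len s)%N -> d + elapsed I s k <= tw_close I (s k).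
    by move=> ks; apply: le_trans (wins k ks); rewrite sub_timeE // le_max lexx.
  split.
    move=> [|k] ks; first by have [] := tw_bounds I (first s).
    exact: le_trans (sub_time_mono _ _ _ d0) (wins k.+1 ks).
  have lls : (0 < len s <= len s)%N by rewrite ls leqnn.
  exists q, (tau (len p)); split=> //.
  have [tE bE] := tl (len s) lls.
  have [+ _] := win _ (leqnn _); rewrite bE sub_batteryE -/(energy_use I s) -/q.
  move=> /andP[be _]; split=> //.
  - by move=> st; apply: taus; rewrite nodep // -/(final p) ps.
  - apply/start_maxP => -[|k] ks; last exact: le_wins.
    (* The departure precedes the arrival at the end, hence the horizon. *)
    rewrite /elapsed big_nil addr0 /= (close_noncustomer (subpath_first ss)).
    rewrite -(close_noncustomer ss.2); apply: le_trans (le_wins _ lls).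
    by rewrite lerDl; apply/travel_time_ge0/subpath_path.
  - by rewrite -subr_ge0.
  - by rewrite qE tE bE sub_batteryE -/(energy_use I s) sub_timeE.
case=> swin [q [tau0 [[tau [tauP win qE]] [tau0_ge0 tau0_st dL eL ->]]]].
have [q0 qB] : 0 <= q.1 /\ 0 <= q.2 <= B by apply: (@path_state_bounds p); exists tau.
pose tau' k := if (k < len p)%N then tau k else if k == len p then tau0 else 0.
have taup k : (k < len p)%N -> tau' k = tau k by rewrite /tau' => ->.
have taupE : tau' (len p) = tau0 by rewrite /tau' ltnn eqxx.
have taus j : (0 < j)%N -> tau' (len p + j)%N = 0.
  by move=> j0; rewrite /tau' ltnNge leq_addr /= -{2}[len p]addn0 eqn_add2l gtn_eqF.
have timep k : (k <= len p)%N ->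
    path_time I (concat p s) tau' k = path_time I p tau k.
  move=> kp; apply: eq_path_time => i ik; last by rewrite taup // (leq_trans ik).
  by rewrite concat_nodel // (leq_trans ik).
have batp k : (k <= len p)%N ->
    path_battery I (concat p s) tau' k = path_battery I p tau k.
  move=> kp; apply: eq_path_battery => i ik; last by rewrite taup // (leq_trans ik).
  by rewrite concat_nodel // (leq_trans ik).
have tl k (ks : (0 < k <= len s)%N) :
    path_time I (concat p s) tau' (len p + k) = sub_time I s (q.1 + tau0) k /\
    path_battery I (concat p s) tau' (len p + k) = sub_battery I s (g_C I q.2 tau0) k.
  have := @path_state_tail tau' k; rewrite taupE => -[] //.
    by move=> j /andP[j0 _]; exact: taus.
  rewrite qE (@eq_path_time p p tau' tau) //.
  by rewrite (@eq_path_battery p p tau' tau) // => ->.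
set d := q.1 + tau0.
have d0 : tw_open I (first s) <= d by rewrite op0 addr_ge0.
have es := subpath_path ss.
exists tau'; rewrite len_concat; split.
- move=> k kps; have [kp|pk|->] := ltngtP k (len p).
  + by rewrite taup // concat_nodel ?(ltnW kp) //; exact/tauP/ltnW.
  + by rewrite -(subnKC (ltnW pk)) taus ?subn_gt0.
  + by rewrite taupE concat_nodel // -/(final p) ps.
- move=> k kps; have [kp|pk] := leqP k (len p).
    by rewrite timep // batp // concat_nodel //; exact: win.
  have kE := subnKC (ltnW pk); set j := (k - len p)%N in kE.
  have jl : (0 < j <= len s)%N by rewrite subn_gt0 pk leq_subLR.
  have jl' : (j <= len s)%N by case/andP: jl.
  rewrite -kE; have [-> ->] := tl j jl; rewrite concat_noder //; split.
    have /andP[lo hi] := sub_battery_bounds (g_C I q.2 tau0) es jl'.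
    have /andP[_ gB] := g_C_range qB tau0_ge0.
    by rewrite (le_trans hi gB) andbT (le_trans _ lo) // subr_ge0.
  rewrite sub_time_open // sub_timeE // ge_max swin // andbT.
  by move/start_maxP: dL; apply.
- have [-> ->] := tl (len s) (introT andP (conj ls (leqnn _))).
  by rewrite sub_batteryE -/(energy_use I s) sub_timeE.
Qed.

End Concat.
End Reachability.

(** * States reached subpath by subpath *)

Section ScheduleRecursion.
Context {R : realType} {V : finType} (I : instance R V).
Local Notation B := (battery I).
Context (p s : nodeseq V) (pp : partial_path I p) (ss : subpath I s).
Context (ls : (0 < len s)%N) (ext : extends_path I s p).
Context (swin : in_windows I s).
Context (bounds : forall q, sched_state I p q -> 0 <= q.1 /\ 0 <= q.2 <= B).

Local Notation m := (size (subpaths I p)).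

Let ps : final p = first s. Proof. by case: ext. Qed.
Let subE : subpaths I (concat p s) = rcons (subpaths I p) s.
Proof. exact: subpaths_concat. Qed.

Let nthl k : (k < m)%N ->
  nth (concat p s) (rcons (subpaths I p) s) k = nth p (subpaths I p) k.
Proof. by move=> km; rewrite nth_rcons km; exact: set_nth_default. Qed.

Let nthr : nth (concat p s) (rcons (subpaths I p) s) m = s.
Proof. by rewrite nth_rcons ltnn eqxx. Qed.

Let len_neq0 : (len (concat p s) == 0%N) = false.
Proof. by rewrite len_concat addn_eq0 [len s == _]eqn0Ngt ls andbF. Qed.

(** The horizon constraint at the end of a leg follows from its latest start. *)
Lemma leg_horizon q tau q' : leg I s q tau q' -> q'.1 <= horizon I.
Proof.
case=> _ _ /start_maxP/(_ _ (leqnn _)) dL _ ->.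
rewrite /= ge_max -(close_noncustomer ss.2) end_min_close // andbT.
exact: dL.
Qed.

(** The resource problem obeys the same recursion as the node-by-node one,
    [path_state_concat]. *)
Lemma sched_state_concat q' : sched_state I (concat p s) q' <->
  exists q tau, sched_state I p q /\ leg I s q tau q'.
Proof.
have BB : 0 <= B <= B by rewrite battery_ge0 lexx.
rewrite {1}/sched_state len_neq0; split.
  case=> Ts [Te [Bs [Be [tau [sch ->]]]]].
  have := sch_nonneg sch; have := sch_charge sch; have := sch_latest sch.
  have := sch_end sch; have := sch_energy sch; have := sch_start sch.
  have := sch_recharge sch; have := sch_start0 sch; have := sch_battery0 sch.
  rewrite subE size_rcons /= => B0 T0 rec sta ene end_ lat cha nn.
  have [p0|lp] := posnP (len p).
    have m0 : m = 0%N by apply/eqP; rewrite subpaths_size_eq0 p0.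
    have nthr0 := nthr; rewrite m0 in nthr0 lat end_ ene nn *.
    have := lat 0%N isT; have := end_ 0%N isT; have := ene 0%N isT.
    rewrite nthr0 T0 B0 => eE tE dL.
    exists (0, B), 0; split; first by rewrite /sched_state p0.
    have [_ _ _ be] := nn 0%N isT.
    split=> //=; first by rewrite addr0.
      by rewrite g_C0 // -subr_ge0 -eE.
    by rewrite addr0 g_C0 // eE tE.
  have m0 : (0 < m)%N by rewrite lt0n subpaths_size_eq0 -lt0n.
  have mE : m.-1.+1 = m by rewrite prednK.
  have latm := lat m (ltnSn _); have endm := end_ m (ltnSn _).
  have enem := ene m (ltnSn _); have [_ _ _ be] := nn m (ltnSn _).
  rewrite nthr in latm endm enem.
  have mm1 : (m.-1.+1 < m.+1)%N by rewrite mE.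
  have stam := sta _ mm1; have recm := rec _ mm1; have cham := cha _ mm1.
  rewrite mE in stam recm.
  exists (Te m.-1, Be m.-1), (tau m.-1); split.
    rewrite /sched_state eqn0Ngt lp /=; exists Ts, Te, Bs, Be, tau; split=> //.
    have up k : (k < m)%N -> (k < m.+1)%N by move=> /ltnW.
    split=> //.
    - by move=> k /up /nn.
    - by move=> k /up /cha.
    - by move=> k km; rewrite -nthl //; exact/lat/up.
    - have stL := le_trans latm (start_max_close I s).
      rewrite (close_noncustomer (subpath_first ss)) stam in stL.
      by apply: le_trans stL; rewrite lerDl.
    - by move=> k km; rewrite -nthl //; exact/end_/up.
    - by move=> k km; rewrite -nthl //; exact/ene/up.
    - by move=> k /up /sta.
    - by move=> k /up /rec.
  split=> //=.
  - by rewrite (extends_station ext lp).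
  - by rewrite -stam.
  - by rewrite -subr_ge0 -recm -enem.
  - by rewrite -stam -recm -enem -endm.
case=> q [tau0 [sq lg]]; have [q0 qB] := bounds sq.
have lgh := leg_horizon lg; case: lg => tau_ge0 tau_st dL eL q'E.
have es := subpath_path ss.
have tr0 := travel_time_ge0 es; have en0 := energy_use_ge0 es.
have d0 : 0 <= q.1 + tau0 by rewrite addr_ge0.
have /andP[gC0 gCB] := g_C_range qB tau_ge0.
have q'1 : 0 <= q'.1 by rewrite q'E /= le_max addr_ge0.
have q'2 : 0 <= q'.2 by rewrite q'E /= subr_ge0.
rewrite subE size_rcons /=.
have [p0|lp] := posnP (len p).
  have m0 : m = 0%N by apply/eqP; rewrite subpaths_size_eq0 p0.
  move: (sq); rewrite /sched_state p0 eqxx => qE; rewrite {}qE /= in q'E dL gC0 gCB eL.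
  have tE : tau0 = 0 by apply/tau_st/(extends_depot pp ext).
  rewrite tE addr0 g_C0 // in q'E dL gC0 gCB eL.
  exists (fun=> 0), (fun=> q'.1), (fun=> B), (fun=> q'.2), (fun=> 0).
  split; last by case: (q').
  have nthr0 := nthr; rewrite m0 in nthr0.
  split=> //; rewrite ?subE ?size_rcons ?m0 //.
  - by move=> [|//] _; rewrite nthr0.
  - by move=> [|//] _; rewrite nthr0 q'E.
  - by move=> [|//] _; rewrite nthr0 q'E.
move: (sq); rewrite /sched_state eqn0Ngt lp /=.
case=> Ts [Te [Bs [Be [tau [sch qE]]]]].
have m0 : (0 < m)%N by rewrite lt0n subpaths_size_eq0 -lt0n.
have mE : m.-1.+1 = m by rewrite prednK.
have nn := sch_nonneg sch; have cha := sch_charge sch; have lat := sch_latest sch.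
have end_ := sch_end sch; have ene := sch_energy sch; have sta := sch_start sch.
have rec := sch_recharge sch; have T0 := sch_start0 sch; have B0 := sch_battery0 sch.
pose ext_ (f : nat -> R) x k := if (k < m)%N then f k else x.
have extl f x k : (k < m)%N -> ext_ f x k = f k by rewrite /ext_ => ->.
have extr f x : ext_ f x m = x by rewrite /ext_ ltnn.
pose tau' k := if (k.+1 < m)%N then tau k else tau0.
have last_or k : (k < m.+1)%N -> (k < m)%N \/ k = m.
  by rewrite ltnS leq_eqVlt => /predU1P[|]; [right|left].
have last_or' k : (k.+1 < m.+1)%N -> (k.+1 < m)%N \/ k = m.-1.
  by case/last_or => [|<-]; [left|right].
exists (ext_ Ts (q.1 + tau0)), (ext_ Te q'.1), (ext_ Bs (g_C I q.2 tau0)),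
  (ext_ Be q'.2), tau'; split; last by rewrite !extr; case: (q').
split; rewrite ?subE ?size_rcons.
- by move=> k /last_or[km|->]; rewrite ?extr ?extl //; exact: nn.
- by move=> k /last_or'[km|->]; rewrite /tau' ?km ?mE ?ltnn //; exact: cha.
- by rewrite extl.
- by rewrite extl.
- by move=> k /last_or[km|->]; rewrite ?nthr ?extr ?extl ?nthl //; exact: lat.
- by rewrite extr.
- by move=> k /last_or[km|->]; rewrite ?nthr ?extr ?extl ?nthl ?q'E //; exact: end_.
- by move=> k /last_or[km|->]; rewrite ?nthr ?extr ?extl ?nthl ?q'E //; exact: ene.
- move=> k /last_or'[km|->]; rewrite /tau' ?km ?mE ?ltnn.
    by rewrite !extl ?(ltnW km) //; exact: sta.
  by rewrite extr extl ?qE ?prednK // -{2}mE.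
- move=> k /last_or'[km|->]; rewrite /tau' ?km ?mE ?ltnn.
    by rewrite !extl ?(ltnW km) //; exact: rec.
  by rewrite extr extl ?qE ?prednK // -{2}mE.
Qed.

End ScheduleRecursion.

(** * Domination between states *)

Section StateDominance.
Context {R : realType} {V : finType} (I : instance R V).
Implicit Types (p s : nodeseq V) (q : R * R).
Local Notation B := (battery I).
Local Notation level := (charge_inv I).

(** [q1] is at least as early as [q2], and reaches at least the same battery level
    if it spends the difference in time on charging. *)
Definition state_dom q1 q2 : Prop :=
  q1.1 <= q2.1 /\ level q2.2 - q2.1 <= level q1.2 - q1.1.

(** A member of [S] that dominates all of [S]. *)
Definition best_state (S : R * R -> Prop) q : Prop :=
  S q /\ forall q', S q' -> state_dom q q'.

Lemma state_dom_refl q : state_dom q q.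
Proof. by []. Qed.

Lemma state_dom_trans q2 q1 q3 : state_dom q1 q2 -> state_dom q2 q3 -> state_dom q1 q3.
Proof.
by move=> [t12 l12] [t23 l23]; split; [exact: le_trans t23 | exact: le_trans l12].
Qed.

Lemma state_dom_le q1 q2 : 0 <= q1.2 <= B -> 0 <= q2.2 <= B ->
  q1.1 <= q2.1 -> q2.2 <= q1.2 -> state_dom q1 q2.
Proof. by move=> b1 b2 t b; split=> //; rewrite lerB // charge_inv_mono. Qed.

(** This is the time condition in the domination of paths. *)
Lemma state_dom_g_T q1 q2 : 0 <= q1.2 <= B -> 0 <= q2.2 <= B ->
  state_dom q1 q2 <->
  q1.1 + g_T I q1.2 (Num.max q1.2 q2.2) <= q2.1.
Proof.
move=> b1 b2; rewrite /state_dom /g_T; case: (leP q1.2 q2.2) => b12.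
  rewrite -(charge_inv_mono b1 b2) in b12.
  by split=> [[_ H]|H]; [|split]; lra.
have {}b12 := ltW b12; rewrite -(charge_inv_mono b2 b1) in b12.
by split=> [[H _]|H]; [|split]; lra.
Qed.

Lemma leg_bounds s q tau q' : path (edge I) (first s) (rest s) ->
  0 <= q.2 <= B -> leg I s q tau q' -> 0 <= q'.2 <= B.
Proof.
move=> es qB [tau0 _ _ eL ->] /=; have /andP[_ gB] := g_C_range qB tau0.
by rewrite subr_ge0 eL /= (le_trans _ gB) // gerBl energy_use_ge0.
Qed.

(** The dominating state waits at the station, charging, until the dominated
    one leaves. *)
Lemma leg_dom_start s q1 q2 tau2 q2' : path (edge I) (first s) (rest s) ->
  first s \in stations I -> 0 <= q1.2 <= B -> 0 <= q2.2 <= B ->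
  state_dom q1 q2 -> leg I s q2 tau2 q2' ->
  exists tau1 q1', leg I s q1 tau1 q1' /\ state_dom q1' q2'.
Proof.
move=> es st b1 b2 [t12 l12] lg2; have b2' := leg_bounds es b2 lg2.
case: (lg2) => tau20 _ dL eL q2'E.
pose tau1 := q2.1 + tau2 - q1.1.
have tau10 : 0 <= tau1 by rewrite /tau1; lra.
have dE : q1.1 + tau1 = q2.1 + tau2 by rewrite /tau1; lra.
have gC : g_C I q2.2 tau2 <= g_C I q1.2 tau1.
  apply: charging_mono; first by rewrite addr_ge0 // charge_inv_ge0.
  by rewrite /tau1; lra.
pose q1' := (Num.max (q1.1 + tau1 + travel_time I s) (end_min I s),
  g_C I q1.2 tau1 - energy_use I s).
have lg1 : leg I s q1 tau1 q1'.
  by split=> //; [rewrite st | rewrite dE | exact: le_trans eL gC].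
exists tau1, q1'; split=> //.
apply: state_dom_le; rewrite ?(leg_bounds es b1 lg1) //.
  by rewrite q2'E /= dE.
by rewrite q2'E /= lerB.
Qed.

(** A dominating subpath can be entered with the same departure time: by the
    bound on durations, a longer travel time still fits before the earliest end of
    the dominated subpath. *)
Lemma leg_dom_subpath kappa mu nu N s1 s2 q tau q2' :
  path (edge I) (first s1) (rest s1) -> path (edge I) (first s2) (rest s2) ->
  0 <= q.2 <= B -> sub_dominates I kappa mu nu N s1 s2 -> leg I s2 q tau q2' ->
  exists q1', leg I s1 q tau q1' /\ state_dom q1' q2'.
Proof.
move=> e1 e2 qB dom lg2; have b2' := leg_bounds e2 qB lg2.
case: (lg2) => tau0 tau_st dL eL q2'E.
pose q1' := (Num.max (q.1 + tau + travel_time I s1) (end_min I s1),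
  g_C I q.2 tau - energy_use I s1).
have lg1 : leg I s1 q tau q1'.
  split=> //; first by rewrite (sd_first dom).
    exact: le_trans dL (sd_start dom).
  exact: le_trans (sd_energy dom) eL.
exists q1'; split=> //; apply: state_dom_le; rewrite ?(leg_bounds e1 qB lg1) //; last first.
  by rewrite q2'E /= lerB // (sd_energy dom).
rewrite q2'E /= ge_max; apply/andP; split; last by rewrite le_max (sd_end dom) orbT.
have := sd_duration dom; rewrite /min_duration ge_max le_max => /andP[/orP[h|h] _].
  by rewrite le_max lerD2l h.
by rewrite le_max; apply/orP; right; lra.
Qed.

(** Traversing a leg never improves the state: the level grows by at most the
    charging time. *)
Lemma leg_dom_stay s q tau q' : path (edge I) (first s) (rest s) ->
  0 <= q.2 <= B -> leg I s q tau q' -> state_dom q q'.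
Proof.
move=> es qB lg; have b' := leg_bounds es qB lg.
case: (lg) => tau0 _ dL eL q'E.
have tr := travel_time_ge0 es; have en := energy_use_ge0 es.
have t' : q.1 + tau <= q'.1.
  by rewrite q'E /= le_max lerDl tr.
have l' : level q'.2 <= level q.2 + tau.
  rewrite charge_inv_le // ?addr_ge0 ?charge_inv_ge0 //.
  by rewrite q'E /= -/(g_C I q.2 tau) gerBl.
by split; lra.
Qed.

(** Among the states reached from [q] along [s] there is a best one. Its charging
    time is the largest that keeps the end time minimal; any further charging
    is done better after [s], from a lower battery level, by concavity. *)
Lemma leg_best s q : path (edge I) (first s) (rest s) -> 0 <= q.2 <= B ->
  (exists tau q', leg I s q tau q') ->
  exists q', best_state (fun q' => exists tau, leg I s q tau q') q'.
Proof.
move=> es qB [tau0 [q0 lg0]].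
have [st|dep] := boolP (first s \in stations I); last first.
  exists q0; split; first by exists tau0.
  move=> q' [tau [_ /(_ dep)-> _ _ ->]].
  by case: lg0 => _ /(_ dep)-> _ _ ->.
case: (lg0) => t0 _ dL eL _.
have en := energy_use_ge0 es.
set e := energy_use I s in eL en *; set x := level q.2.
have x0 : 0 <= x by exact: charge_inv_ge0.
have /andP[_ gB] := g_C_range qB t0.
have eB : 0 <= e <= B by rewrite en (le_trans eL gB).
(* Shortest charging time that makes the leg possible. *)
pose tmin := Num.max 0 (level e - x).
have tmin0 : 0 <= tmin by rewrite /tmin le_max lexx.
have tmin_le tau : 0 <= tau -> (tmin <= tau) = (e <= g_C I q.2 tau).
  move=> h; rewrite /tmin ge_max h /= -charge_inv_le ?addr_ge0 //.
  by rewrite lerBlDl.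
pose T' := Num.max (q.1 + tmin + travel_time I s) (end_min I s).
pose ts := Num.min (start_max I s - q.1) (T' - travel_time I s - q.1).
have tmin_ts : tmin <= ts.
  have := tmin_le _ t0; rewrite eL => h.
  have hT : q.1 + tmin + travel_time I s <= T' by rewrite /T' le_max lexx.
  by rewrite /ts le_min; apply/andP; split; lra.
have ts0 : 0 <= ts := le_trans tmin0 tmin_ts.
have tsL : ts <= start_max I s - q.1 by rewrite /ts ge_min lexx.
have tsT : ts <= T' - travel_time I s - q.1 by rewrite /ts ge_min lexx orbT.
have tsE : Num.max (q.1 + ts + travel_time I s) (end_min I s) = T'.
  apply/eqP; rewrite eq_le; apply/andP; split.
    rewrite ge_max; apply/andP; split; first by lra.
    by rewrite /T' le_max lexx orbT.
  by rewrite /T' le_max2 // lerD2r lerD2l.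
have lgs : leg I s q ts (T', g_C I q.2 ts - e).
  split=> //; [by rewrite st | by lra | by rewrite -tmin_le | by rewrite tsE].
exists (T', g_C I q.2 ts - e); split; first by exists ts.
have bs := leg_bounds es qB lgs.
move=> q' [tau lg]; have b' := leg_bounds es qB lg.
case: (lg) => tau_ge0 _ dL' eL' q'E.
have tau_min : tmin <= tau by rewrite tmin_le.
have T'q' : T' <= q'.1 by rewrite q'E /T' le_max2 // lerD2r lerD2l.
have [tau_ts|ts_tau] := leP tau ts.
  apply: state_dom_le => //; rewrite q'E /= lerD2r.
  by apply: charging_mono; rewrite ?addr_ge0 // lerD2l.
split=> //=.
(* The latest departure does not bind, so the end time grows with [tau]. *)
have tsE' : ts = T' - travel_time I s - q.1.
  rewrite /ts min_r // leNgt; apply/negP => h.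
  by move: ts_tau; rewrite /ts min_l ?(ltW h) //; lra.
have t' : T' + (tau - ts) <= q'.1.
  by rewrite q'E /= le_max; apply/orP; left; lra.
rewrite /= in bs; set b := g_C I q.2 ts - e in bs *.
have lb : level b <= x + ts.
  by rewrite charge_inv_le //; [rewrite /b /g_C -/x gerBl | exact: addr_ge0].
have d0 : 0 <= tau - ts by lra.
have := charging_increment I (charge_inv_ge0 bs) lb d0; rewrite charging_level //.
have -> : x + ts + (tau - ts) = x + tau by lra.
move=> inc.
suff : level q'.2 <= level b + (tau - ts) by lra.
rewrite charge_inv_le //; last by have := charge_inv_ge0 bs; lra.
by rewrite q'E /= -/e /g_C -/x; move: inc; rewrite {2}/b /g_C -/x; lra.
Qed.

End StateDominance.

(** * Extending paths by subpaths *)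

Section PathExtension.
Context {R : realType} {V : finType} (I : instance R V).
Context (kappa mu nu : V -> R) (N : V -> {set V}).
Implicit Types (p s : nodeseq V) (q : R * R).

(** Both resource computations reach the same states, and one of these dominates
    all the others. *)
Lemma path_state_best p : partial_path I p -> (exists q, path_state I p q) ->
  (forall q, path_state I p q <-> sched_state I p q) /\
  exists q, best_state I (path_state I p) q.
Proof.
move: p; apply: partial_path_ind => [p pp p0 _|p s pp ss ls ext IH [q' pq']].
  have E := path_state0 pp p0; split=> [q|].
    by rewrite E /sched_state p0 eqxx.
  exists (0, battery I); split; first exact/E.
  by move=> q /E ->; exact: state_dom_refl.
have C := path_state_concat ss ls ext.
have [swin [q [tau [pq lg]]]] := (C q').1 pq'.
have [E [q0 [pq0 best0]]] := IH (ex_intro _ q pq).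
have bnd r : sched_state I p r -> 0 <= r.1 /\ 0 <= r.2 <= battery I.
  by move=> /E; exact: path_state_bounds.
have C' := sched_state_concat pp ss ls ext swin bnd.
split.
  move=> r; split.
    move=> /C[_ [r0 [tau0 [pr0 lg0]]]]; apply/C'; exists r0, tau0.
    by split=> //; exact/E.
  move=> /C'[r0 [tau0 [pr0 lg0]]]; apply/C; split=> //; exists r0, tau0.
  by split=> //; exact/E.
have es := subpath_path ss; have [_ b0] := path_state_bounds pq0.
have from0 r tau1 r' : path_state I p r -> leg I s r tau1 r' ->
    exists tau2 r2, leg I s q0 tau2 r2 /\ state_dom I r2 r'.
  move=> pr lgr; have [p0|lp] := posnP (len p).
    have P0 := path_state0 pp p0.
    move/P0: pr lgr => ->; move/P0: pq0 => -> lgr.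
    by exists tau1, r'; split=> //; exact: state_dom_refl.
  have [_ br] := path_state_bounds pr.
  by apply: leg_dom_start lgr => //; [exact: extends_station ext lp | exact: best0].
have [tau1 [r1 [lg1 _]]] := from0 _ _ _ pq lg.
have [r [[tau2 lgr] bestr]] := leg_best es b0 (ex_intro _ tau1 (ex_intro _ r1 lg1)).
exists r; split; first by apply/C; split=> //; exists q0, tau2.
move=> r' /C[_ [r0 [tau3 [pr0 lg3]]]].
have [tau4 [r4 [lg4 dom4]]] := from0 _ _ _ pr0 lg3.
by apply: state_dom_trans dom4; apply: bestr; exists tau4.
Qed.

(** The best state realizes both the minimal end time and the maximal battery
    level at that time. *)
Lemma path_best p : partial_path I p -> (exists q, path_state I p q) ->
  exists q, [/\ best_state I (path_state I p) q, path_end_min I p = q.1 &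
    path_battery_max I p = q.2].
Proof.
move=> pp ex; have [E [q [pq best]]] := path_state_best pp ex.
exists q; have [q0 qB] := path_state_bounds pq.
have sq : sched_state I p q by exact/E.
have [p0|lp] := posnP (len p).
  have qE : q = (0, battery I) by move: sq; rewrite /sched_state p0.
  by split; [split | rewrite qE /path_end_min p0 | rewrite qE /path_battery_max p0].
have stE r : (exists Ts Te Bs Be tau, schedule I p Ts Te Bs Be tau /\
    r = (Te (size (subpaths I p)).-1, Be (size (subpaths I p)).-1)) <->
    path_state I p r.
  by rewrite E /sched_state eqn0Ngt lp.
have TE : path_end_min I p = q.1.
  rewrite /path_end_min eqn0Ngt lp /=.
  have [Ts [Te [Bs [Be [tau [sch qE]]]]]] := (stE q).2 pq.
  set S := [set u | _]%classic; have Sq : S q.1.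
    by exists Ts, Te, Bs, Be, tau; rewrite qE.
  have Slb : lbound S q.1.
    move=> u [Ts' [Te' [Bs' [Be' [tau' [sch' ->]]]]]].
    have /best[] // : path_state I p
        (Te' (size (subpaths I p)).-1, Be' (size (subpaths I p)).-1).
    by apply/stE; exists Ts', Te', Bs', Be', tau'.
  apply/eqP; rewrite eq_le; apply/andP; split.
    by apply: ge_inf => //; exists q.1.
  by apply: lb_le_inf => //; exists q.1.
split=> //; rewrite /path_battery_max eqn0Ngt lp /= TE.
have [Ts [Te [Bs [Be [tau [sch qE]]]]]] := (stE q).2 pq.
set S := [set b | _]%classic; have Sq : S q.2.
  by exists Ts, Te, Bs, Be, tau; rewrite qE.
have Sub : ubound S q.2.
  move=> b [Ts' [Te' [Bs' [Be' [tau' [sch' tE' bE']]]]]].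
  have pr : path_state I p (q.1, b).
    by apply/stE; exists Ts', Te', Bs', Be', tau'; split=> //; rewrite tE' bE'.
  have [_] := best _ pr; have [_ bB] := path_state_bounds pr.
  by rewrite /= lerD2r charge_inv_mono.
apply/eqP; rewrite eq_le; apply/andP; split.
  by apply: ge_sup => //; exists q.2.
by apply: ub_le_sup => //; exists q.2.
Qed.

Lemma path_dominates_time p1 p2 q1 q2 : path_state I p1 q1 -> path_state I p2 q2 ->
  path_end_min I p1 = q1.1 -> path_battery_max I p1 = q1.2 ->
  path_end_min I p2 = q2.1 -> path_battery_max I p2 = q2.2 ->
  path_end_min I p1 + g_T I (path_battery_max I p1)
    (Num.max (path_battery_max I p1) (path_battery_max I p2)) <= path_end_min I p2
  <-> state_dom I q1 q2.
Proof.
move=> /path_state_bounds[_ b1] /path_state_bounds[_ b2] -> -> -> ->.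
by rewrite -state_dom_g_T.
Qed.

(** To compare two paths it is enough that each reachable state of the second
    is dominated by a reachable state of the first. *)
Lemma path_time_dominates p1 p2 : partial_path I p1 -> partial_path I p2 ->
  (exists q, path_state I p2 q) ->
  (forall q2, path_state I p2 q2 ->
     exists q1, path_state I p1 q1 /\ state_dom I q1 q2) ->
  path_end_min I p1 + g_T I (path_battery_max I p1)
    (Num.max (path_battery_max I p1) (path_battery_max I p2)) <= path_end_min I p2.
Proof.
move=> pp1 pp2 ex2 dom; have [q2 [[pq2 _] T2 B2]] := path_best pp2 ex2.
have [q [pq dq]] := dom _ pq2.
have [q1 [[pq1 best1] T1 B1]] := path_best pp1 (ex_intro _ q pq).
by apply/(path_dominates_time pq1 pq2) => //; apply: state_dom_trans dq; exact: best1.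
Qed.

Lemma path_dominates_refl p : admissible_path I N p ->
  path_dominates I kappa mu nu N p p.
Proof.
move=> [pp /path_feasibleP[_ ex] _]; split=> //.
by apply: path_time_dominates => // q pq; exists q; split=> //; exact: state_dom_refl.
Qed.

Lemma extends_len s p1 p2 : partial_path I p1 -> partial_path I p2 ->
  final p1 = final p2 -> extends_path I s p2 -> len p1 = 0%N -> len p2 = 0%N.
Proof.
move=> [_ f1 _ _] _ e [_ [st|//]] l1; move: st.
by rewrite -e /final l1 (negPf (depot_not_station f1)).
Qed.

(** Domination of paths is preserved by extension along a subpath. *)
Lemma path_extension p1 p2 s :
  admissible_path I N p1 -> admissible_path I N p2 ->
  path_dominates I kappa mu nu N p1 p2 ->
  admissible_subpath I N s -> extends_path I s p1 -> extends_path I s p2 ->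
  admissible_path I N (concat p2 s) ->
  admissible_path I N (concat p1 s) /\
  path_dominates I kappa mu nu N (concat p1 s) (concat p2 s).
Proof.
move=> adm1 adm2 dom [ss _ ngs] ext1 ext2 adm2s.
have [s0|ls] := posnP (len s); first by rewrite !concat_len0.
have [pp1 /path_feasibleP[_ ex1] ng1] := adm1.
have [pp2 /path_feasibleP[_ ex2] ng2] := adm2.
have [l1|l1] := posnP (len p1).
  have l2 := extends_len pp1 pp2 (pd_final dom) ext2 l1.
  have -> : p1 = p2.
    move: (pd_first dom) l1 l2; case: (p1) (p2) => [x l] [y k] /= ->.
    by rewrite /len /= => /size0nil -> /size0nil ->.
  by split=> //; exact: path_dominates_refl.
have l2 : (0 < len p2)%N.
  rewrite lt0n; apply/eqP => /(extends_len pp2 pp1 (esym (pd_final dom)) ext1) l1'.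
  by rewrite l1' in l1.
have [ps1 _] := ext1; have [ps2 _] := ext2.
have [pp2s /path_feasibleP[ld2s ex2s] ng2s] := adm2s.
have pp1s := concat_partial_path pp1 ss ext1.
have es := subpath_path ss.
have load12 : load I (concat p1 s) <= load I (concat p2 s).
  by rewrite !load_concat // lerD2r (pd_load dom).
have [q1 [[pq1 best1] T1 B1]] := path_best pp1 ex1.
have [q2 [[pq2 best2] T2 B2]] := path_best pp2 ex2.
have dom12 := (path_dominates_time pq1 pq2 T1 B1 T2 B2).1 (pd_time dom).
have step r2 : path_state I (concat p2 s) r2 ->
    exists r1, path_state I (concat p1 s) r1 /\ state_dom I r1 r2.
  move=> /(path_state_concat ss ls ext2)[swin [q [tau [pq lg]]]].
  have [_ b1] := path_state_bounds pq1; have [_ b] := path_state_bounds pq.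
  have [tau1 [r1 [lg1 d1]]] := leg_dom_start es (extends_station ext1 l1) b1 b
    (state_dom_trans dom12 (best2 _ pq)) lg.
  exists r1; split=> //; apply/(path_state_concat ss ls ext1).
  by split=> //; exists q1, tau1.
have ex1s : exists q, path_state I (concat p1 s) q.
  by have [r2 /step[r1 [pr1 _]]] := ex2s; exists r1.
split.
  split=> //; first by apply/path_feasibleP; split=> //; exact: le_trans load12 ld2s.
  have [_ _ cross] := (ng_feasible_concat N ps2).1 ng2s.
  apply/ng_feasible_concat => //; split=> // x x1 xs.
  by rewrite (pd_final dom); exact: cross (fintype.subsetP (pd_forward dom) _ x1) xs.
split=> //.
- exact: pd_first dom.
- by rewrite !final_concat.
- by rewrite !arc_sum_concat // lerD2r (pd_cost dom).
- exact: path_time_dominates.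
- apply/fintype.subsetP => x /(ng_forward_concat N ps1) h.
  apply/(ng_forward_concat N ps2); case: h => [|[x1 xs]]; first by left.
  by right; split=> //; exact: (fintype.subsetP (pd_forward dom) _ x1).
Qed.

(** Appending a dominating subpath instead of a dominated one gives a dominating
    path. *)
Lemma subpath_exchange s1 s2 p :
  admissible_subpath I N s1 -> admissible_subpath I N s2 ->
  sub_dominates I kappa mu nu N s1 s2 ->
  admissible_path I N p -> extends_path I s1 p -> extends_path I s2 p ->
  admissible_path I N (concat p s2) ->
  admissible_path I N (concat p s1) /\
  path_dominates I kappa mu nu N (concat p s1) (concat p s2).
Proof.
move=> [ss1 feas1 ng1] [ss2 _ ng2] dom [pp _ ngp] ext1 ext2.
move=> [pp2 /path_feasibleP[ld2 ex2] ngp2].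
have [ps1 _] := ext1; have [ps2 _] := ext2.
have pp1 := concat_partial_path pp ss1 ext1.
have e1 := subpath_path ss1; have e2 := subpath_path ss2.
have [_ _ swin1] := (sub_feasibleP e1).1 feas1.
have load12 : load I (concat p s1) <= load I (concat p s2).
  by rewrite !load_concat // lerD2l (sd_first dom) lerD2r (sd_load dom).
have step r2 : path_state I (concat p s2) r2 ->
    exists r1, path_state I (concat p s1) r1 /\ state_dom I r1 r2.
  have [l2|l2] := posnP (len s2).
    have l1 : len s1 = 0%N.
      apply/eqP; rewrite eqn0Ngt; apply/negP => /(sub_dominates_len e1 dom).
      by rewrite l2.
    by rewrite !concat_len0 // => pr; exists r2; split=> //; exact: state_dom_refl.
  move=> /(path_state_concat ss2 l2 ext2)[_ [q [tau [pq lg]]]].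
  have [_ b] := path_state_bounds pq.
  have [l1|l1] := posnP (len s1).
    by rewrite concat_len0 //; exists q; split=> //; exact: leg_dom_stay lg.
  have [r1 [lg1 d1]] := leg_dom_subpath e1 e2 b dom lg.
  exists r1; split=> //; apply/(path_state_concat ss1 l1 ext1).
  by split=> //; exists q, tau.
have ex1 : exists q, path_state I (concat p s1) q.
  by have [r2 /step[r1 [pr1 _]]] := ex2; exists r1.
split.
  split=> //; first by apply/path_feasibleP; split=> //; exact: le_trans load12 ld2.
  have [_ _ cross] := (ng_feasible_concat N ps2).1 ngp2.
  apply/ng_feasible_concat => //; split=> // x xp x1.
  exact: cross xp (fintype.subsetP (sd_backward dom) _ x1).
split=> //.
- by rewrite !final_concat // (sd_final dom).
- by rewrite !arc_sum_concat // lerD2l (sd_cost dom).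
- exact: path_time_dominates.
- apply/fintype.subsetP => x /(ng_forward_concat N ps1) h.
  apply/(ng_forward_concat N ps2); case: h => [x1|[xp x1]].
    by left; exact: (fintype.subsetP (sd_forward dom) _ x1).
  by right; split=> //; exact: (fintype.subsetP (sd_residue dom) _ x1).
Qed.

End PathExtension.

Theorem proposition8 (R : realType) (V : finType) (I : instance R V)
  (kappa mu nu : V -> R) (N : V -> {set V}) (hN : ng_neighborhood I N) :
  (forall (s1 s2 : nodeseq V) (a : V * V),
     admissible_partial_subpath I N s1 -> admissible_partial_subpath I N s2 ->
     sub_dominates I kappa mu nu N s1 s2 ->
     edge I a.1 a.2 -> a.1 = final s1 -> a.1 = final s2 ->
     admissible_partial_subpath I N (add_arc s2 a) ->
     admissible_partial_subpath I N (add_arc s1 a) /\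
     sub_dominates I kappa mu nu N (add_arc s1 a) (add_arc s2 a))
  /\
  (forall (p1 p2 s : nodeseq V),
     admissible_path I N p1 -> admissible_path I N p2 ->
     path_dominates I kappa mu nu N p1 p2 ->
     admissible_subpath I N s -> extends_path I s p1 -> extends_path I s p2 ->
     admissible_path I N (concat p2 s) ->
     admissible_path I N (concat p1 s) /\
     path_dominates I kappa mu nu N (concat p1 s) (concat p2 s))
  /\
  (forall (s1 s2 p : nodeseq V),
     admissible_subpath I N s1 -> admissible_subpath I N s2 ->
     sub_dominates I kappa mu nu N s1 s2 ->
     admissible_path I N p -> extends_path I s1 p -> extends_path I s2 p ->
     admissible_path I N (concat p s2) ->
     admissible_path I N (concat p s1) /\
     path_dominates I kappa mu nu N (concat p s1) (concat p s2)).
Proof.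
split; last split.
- move=> s1 s2 a; rewrite !add_arc_concat; exact: sub_extension.
- by move=> p1 p2 s; exact: path_extension.
- by move=> s1 s2 p; exact: subpath_exchange.
Qed.
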